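(* Let $E:y^2=x^3+ax$ be a Kachisa-Schaefer-Scott curve of embedding degree $16$ over $\mathbb{F}_p$ with parameter $u\in\mathbb{Z}$. Let $P\in\mathbb{G}_1$ and $Q\in\mathbb{G}_2$ be non-trivial points, let $E_\eta$ be the quartic twist of $E$, with twisting isomorphism $\sigma_\eta$, and let $\widetilde P=(x_{\widetilde P},y_{\widetilde P})$, $\widetilde Q=(x_{\widetilde Q},y_{\widetilde Q})$ be the points of $E_\eta$ with $\sigma_\eta(\widetilde P)=P$ and $\sigma_\eta(\widetilde Q)=Q$. Let $\widetilde W=W_{\widetilde Q,\widetilde P}$ be the elliptic net associated to $E_\eta,\widetilde Q,\widetilde P$, and set $$A=x_{\widetilde Q}\widetilde W(u,0)^2-\widetilde W(u-1,0)\widetilde W(u+1,0),$$ $$B=\frac{\widetilde W(u-1,0)^2\widetilde W(u+2,0)-\widetilde W(u+1,0)^2\widetilde W(u-2,0)}{4y_{\widetilde Q}},$$ $$\ell_1=\bigl(A-\eta^{2(p-1)}\widetilde W(u,0)^2x_{\widetilde Q}^p\bigr)\bigl(\widetilde W(u,0)^3y_{\widetilde P}-B\bigr)-\bigl(B-\eta^{3(p-1)}\widetilde W(u,0)^3y_{\widetilde Q}^p\bigr)\bigl(\widetilde W(u,0)^2x_{\widetilde P}-A\bigr),$$ $$\ell_2=(3\eta^4x_{\widetilde Q}^2+a)x_{\widetilde P}-2\eta^4y_{\widetilde Q}y_{\widetilde P}+2\eta^4y_{\widetilde Q}^2-3\eta^4x_{\widetilde Q}^3-ax_{\widetilde Q}.$$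 Then the optimal Ate pairing $$e_3(Q,P)=\Bigl(\bigl(f_{u,Q}(P)\cdot\ell_{[u]Q,[p]Q}(P)\bigr)^{p^3}\cdot\ell_{Q,Q}(P)\Bigr)^{\frac{p^{16}-1}{r}}$$ satisfies $$e_3(Q,P)=\Bigl(\bigl(\widetilde W(u,1)\cdot\ell_1\bigr)^{p^3}\cdot\ell_2\Bigr)^{\frac{p^{16}-1}{r}}.$$
   Context: Curve family. With integer parameter $u$, the KSS16 family has $p=\frac{1}{980}(u^{10}+2u^9+5u^8+48u^6+152u^5+240u^4+625u^2+2398u+3125)$, $r=\frac{1}{61250}(u^8+48u^4+625)$, $t=\frac{1}{35}(2u^5+41u+35)$. Here $p>3$ and $r$ are primes, and $E:y^2=x^3+ax$ over $\mathbb{F}_p$ has $p+1-t$ rational points over $\mathbb{F}_p$, with $r\mid p+1-t$ and embedding degree $16$ with respect to $r$ (the smallest positive integer $k$ with $r\mid p^k-1$ is $16$). Groups. Let $\pi_p(x,y)=(x^p,y^p)$ be the Frobenius map on $E$. Then $\mathbb{G}_1=E(\overline{\mathbb{F}}_p)[r]\cap\ker(\pi_p-[1])$ and $\mathbb{G}_2=E(\overline{\mathbb{F}}_p)[r]\cap\ker(\pi_p-[p])$. Miller function and lines. For $n\in\mathbb{Z}$, $f_{n,Q}$ is the normalized (leading coefficient $1$ at $\mathcal{O}$) rational function on $E$ with divisor $n(Q)-([n]Q)-(n-1)(\mathcal{O})$. $\ell_{R,S}$ denotes the line through $R$ and $S$ (the tangent line at $R$ if $R=S$), normalized as $y-y_R-\lambda(x-x_R)$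 with $\lambda$ its slope. Twist. Let $\eta\in\mathbb{F}_{p^{16}}^*$ be such that $\eta^4\in\mathbb{F}_{p^4}$ and $(1,\eta,\eta^2,\eta^3)$ is a basis of $\mathbb{F}_{p^{16}}$ over $\mathbb{F}_{p^4}$. The quartic twist is $E_\eta:y^2=x^3+\eta^{-4}ax$ over $\mathbb{F}_{p^4}$, with isomorphism $\sigma_\eta:E_\eta\to E$, $(x,y)\mapsto(\eta^2x,\eta^3y)$ (defined over $\mathbb{F}_{p^{16}}$). The twist is the one for which the point $\widetilde Q$ corresponding to $Q\in\mathbb{G}_2$ lies in $E_\eta(\mathbb{F}_{p^4})$. Elliptic nets. An elliptic net is a map $W$ from a finitely generated free abelian group $\mathcal A$ to an integral domain such that for all $p,q,r,s\in\mathcal A$, $$W(p+q+s)W(p-q)W(r+s)W(r)+W(q+r+s)W(q-r)W(p+s)W(p)+W(r+p+s)W(r-p)W(q+s)W(q)=0.$$ For a curve $y^2=x^3+A_0x+B_0$ and points $S=(x_1,y_1)$, $R=(x_2,y_2)$ on it with $S,R,S+R,S-R\neq\mathcal O$, the elliptic net $W_{S,R}:\mathbb{Z}^2\to\mathbb{K}$ associated to the curve and $S,R$ (in this order) is Stange's net, i.e. the elliptic net with $W(0,0)=0$, $W(-v)=-W(v)$ and initial values $W(1,0)=W(0,1)=W(1,1)=1$, $W(2,0)=2y_1$, $W(3,0)=3x_1^4+6A_0x_1^2+12B_0x_1-A_0^2$, $W(4,0)=4y_1(x_1^6+5A_0x_1^4+20B_0x_1^3-5A_0^2x_1^2-4A_0B_0x_1-8B_0^2-A_0^3)$,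 $W(2,1)=2x_1+x_2-\left(\frac{y_2-y_1}{x_2-x_1}\right)^2$, $W(-1,1)=x_1-x_2$, $W(2,-1)=(y_1+y_2)^2-(2x_1+x_2)(x_1-x_2)^2$. (Over $\mathbb{C}$, $W_{S,R}(v_1,v_2)=\sigma(v_1z_1+v_2z_2)\,\sigma(z_1)^{-(v_1^2-v_1v_2)}\sigma(z_1+z_2)^{-v_1v_2}\sigma(z_2)^{-(v_2^2-v_1v_2)}$, where $\sigma$ is the Weierstrass sigma function and $z_1,z_2$ correspond to $S,R$.) *)

(* Defs.v *)
From HB Require Import structures.
From mathcomp Require Import all_boot all_order all_algebra all_field.
From mathcomp Require Import boolp classical_sets.

Set Implicit Arguments.
Unset Strict Implicit.
Unset Printing Implicit Defensive.

Import GRing.Theory.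

Local Open Scope ring_scope.

(* [None] is the point at infinity. *)
Notation point F := (option (F * F)%type).

Section Points.

Variable F : fieldType.
Implicit Types (a b x y : F) (P Q R S : point F).

Definition on_curve a b P : bool :=
  if P is Some (x, y) then y ^+ 2 == x ^+ 3 + a * x + b else true.

(* Slope of the chord, or of the tangent when the two points are equal.  It is
   meaningless for a vertical line. *)
Definition slope a (R S : F * F) : F :=
  let: (xR, yR) := R in let: (xS, yS) := S in
  if R == S then (3 * xR ^+ 2 + a) / (2 * yR) else (yS - yR) / (xS - xR).

Definition oppp P : point F :=
  if P is Some (x, y) then Some (x, - y) else None.

Definition addp a P Q : point F :=
  match P, Q with
  | None, _ => Q
  | _, None => P
  | Some (x1, y1), Some (x2, y2) =>
      if (x1 == x2) && (y1 == - y2) then None else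
      let l := slope a (x1, y1) (x2, y2) in
      let x3 := l ^+ 2 - x1 - x2 in
      Some (x3, l * (x1 - x3) - y1)
  end.

Definition subp a P Q : point F := addp a P (oppp Q).

Definition mulp a (n : int) P : point F :=
  match n with
  | Posz m => iter m (addp a P) None
  | Negz m => oppp (iter m.+1 (addp a P) None)
  end.

(* The value at [P] of the line through the finite points [R] and [S]. *)
Definition line a R S P : F :=
  match R, S, P with
  | Some (xR, yR), Some (xS, yS), Some (x, y) =>
      y - yR - slope a (xR, yR) (xS, yS) * (x - xR)
  | _, _, _ => 0
  end.

Definition frobp (p : nat) P : point F :=
  if P is Some (x, y) then Some (x ^+ p, y ^+ p) else None.

(* P is in E[r] and in the kernel of pi_p - [n]. *)
Definition frob_eigen (p r : nat) a b (n : int) P : Prop :=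
  [/\ on_curve a b P, mulp a r%:Z P = None
    & subp a (frobp p P) (mulp a n P) = None].

Definition in_G1 (p r : nat) a b P : Prop := frob_eigen p r a b 1 P.
Definition in_G2 (p r : nat) a b P : Prop := frob_eigen p r a b p%:Z P.

End Points.

Section FunctionField.

Variables (K : fieldType) (a b : K).

Definition weierstrass_rhs : {poly K} := 'X^3 + a *: 'X + b%:P.

(* Y^2 - (x^3 + a x + b), as a polynomial in Y over K(x). *)
Definition weierstrass_poly : {poly {fraction {poly K}}} :=
  'X^2 - (tofrac weierstrass_rhs)%:P.

Lemma size_weierstrass_rhs : size weierstrass_rhs = 4.
Proof.
rewrite /weierstrass_rhs -addrA size_polyDl size_polyXn //.
apply: leq_ltn_trans (size_polyD _ _) _; rewrite gtn_max.
rewrite (leq_ltn_trans (size_scale_leq _ _)) ?size_polyX //.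
by rewrite (leq_ltn_trans (size_polyC_leq1 _)).
Qed.

Lemma weierstrass_rhs_nonsquare (z : {fraction {poly K}}) :
  z ^+ 2 != tofrac weierstrass_rhs.
Proof.
have rhs0 : weierstrass_rhs != 0 by rewrite -size_poly_eq0 size_weierstrass_rhs.
have [d d0 [n zd]] :
    exists2 d : {poly K}, d != 0 & exists n, z * tofrac d = tofrac n.
  elim/quotP: z => r _; exists \d_r; first exact: denom_ratioP.
  exists \n_r; rewrite !piE; apply/eqP.
  rewrite FracField.equivf_def /FracField.mulf.
  by rewrite !numden_Ratio ?mulr1 ?oner_neq0 ?denom_ratioP // mulrC.
apply/eqP => z2; have : (n ^+ 2 == weierstrass_rhs * d ^+ 2).
  by rewrite -tofrac_eq expr2 !tofracM -zd mulrACA -expr2 z2 -expr2.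
have [-> | n0] := eqVneq n 0.
  by rewrite expr0n eq_sym mulf_eq0 (negPf rhs0) expf_eq0 (negPf d0).
move=> /eqP /(congr1 (fun q : {poly K} => odd (size q))).
rewrite !expr2 !size_mul ?mulf_neq0 // size_weierstrass_rhs.
move: n0 d0; rewrite -!size_poly_gt0.
by case: (size n) (size d) => [|i] [|j] //= _ _;
  by rewrite ?addSn ?addnS /= ?addnn /= ?negbK ?odd_double.
Qed.

Lemma weierstrass_poly_irreducible : monic_irreducible_poly weierstrass_poly.
Proof.
have sz : size weierstrass_poly = 3.
  by rewrite size_polyDl size_polyXn // size_polyN (leq_ltn_trans (size_polyC_leq1 _)).
split; last first.
  rewrite monicE lead_coefDl ?lead_coefXn // size_polyN size_polyXn.
  by rewrite (leq_ltn_trans (size_polyC_leq1 _)).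
apply: cubic_irreducible => [|z]; first by rewrite sz.
by rewrite rootE !hornerE subr_eq0 weierstrass_rhs_nonsquare.
Qed.

(* K(E) = K(x)[Y] / (Y^2 - (x^3 + a x + b)). *)
Definition funfield := {poly %/ weierstrass_poly with weierstrass_poly_irreducible}.

Definition funC (c : K) : funfield := (tofrac c%:P)%:A.
Definition funX : funfield := (tofrac 'X)%:A.
Definition funY : funfield := in_qpoly weierstrass_poly 'X.

(* Affine coordinates around [P]: (x, y) at a finite point, and (x/y, 1/y),
   which vanish at the point at infinity, otherwise. *)
Definition chart (P : point K) : (funfield * funfield) * (K * K) :=
  if P is Some xy then ((funX, funY), xy)
  else ((funX / funY, funY^-1), (0, 0)).

(* [f] is regular at [P] with value [c]: f = s / t with s and t polynomials in
   the coordinates around [P] and t(P) <> 0. *)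
Definition has_value (f : funfield) (P : point K) (c : K) : Prop :=
  let: ((X, Y), (x, y)) := chart P in
  exists s t : {poly {poly K}},
    [/\ t.[x, y] != 0,
        f = (map_poly (map_poly funC) s).[X, Y]
              / (map_poly (map_poly funC) t).[X, Y]
      & c = s.[x, y] / t.[x, y]].

(* The value of [f] at [P], and 0 when [f] has a pole at [P]. *)
Definition funeval (f : funfield) (P : point K) : K :=
  xget 0 (has_value f P).

(* A local parameter at [P], when the characteristic is not 2 and the curve is
   nonsingular. *)
Definition uniformizer (P : point K) : funfield :=
  if P is Some (x, y) then if y == 0 then funY else funX - funC x
  else funX / funY.

(* [f] has order [n] at [P], with leading coefficient [c] with respect to
   [uniformizer P]. *)
Definition leading (f : funfield) (P : point K) (n : int) (c : K) : Prop :=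
  exists h : funfield,
    [/\ f = uniformizer P ^ n * h, has_value h P c & c != 0].

Definition has_divisor (f : funfield) (D : point K -> int) : Prop :=
  forall P, on_curve a b P -> exists c, leading f P (D P) c.

(* With respect to x/y, the functions x, y and the lines
   y - y_R - lambda (x - x_R) have leading coefficient 1 at infinity. *)
Definition normalized (f : funfield) : Prop :=
  exists n : int, leading f None n 1.

Definition is_miller (n : int) (Q : point K) (f : funfield) : Prop :=
  has_divisor f (fun R => n * (R == Q)%:R - (R == mulp a n Q)%:R
                          - (n - 1) * (R == None)%:R)
  /\ normalized f.

Definition miller (n : int) (Q : point K) : funfield :=
  xget 0 (is_miller n Q).

End FunctionField.

Section EllipticNets.

Definition elliptic_net (A : zmodType) (D : idomainType) (W : A -> D) : Prop :=
  forall p q r s : A,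
    W (p + q + s) * W (p - q) * W (r + s) * W r
    + W (q + r + s) * W (q - r) * W (p + s) * W p
    + W (r + p + s) * W (r - p) * W (q + s) * W q = 0.

(* [W] is the net W_{S,R} associated to y^2 = x^3 + a x + b and the points
   S = (x1, y1), R = (x2, y2). *)
Definition stange_net (K : fieldType) (a b : K) (S R : K * K)
    (W : int * int -> K) : Prop :=
  let: (x1, y1) := S in let: (x2, y2) := R in
  elliptic_net W
  /\ W (0, 0) = 0 /\ (forall v, W (- v) = - W v)
  /\ W (1, 0) = 1 /\ W (0, 1) = 1 /\ W (1, 1) = 1
  /\ W (2, 0) = 2 * y1
  /\ W (3, 0) = 3 * x1 ^+ 4 + 6 * a * x1 ^+ 2 + 12 * b * x1 - a ^+ 2
  /\ W (4, 0) = 4 * y1 * (x1 ^+ 6 + 5 * a * x1 ^+ 4 + 20 * b * x1 ^+ 3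
                          - 5 * a ^+ 2 * x1 ^+ 2 - 4 * a * b * x1
                          - 8 * b ^+ 2 - a ^+ 3)
  /\ W (2, 1) = 2 * x1 + x2 - ((y2 - y1) / (x2 - x1)) ^+ 2
  /\ W (-1, 1) = x1 - x2
  /\ W (2, -1) = (y1 + y2) ^+ 2 - (2 * x1 + x2) * (x1 - x2) ^+ 2.

End EllipticNets.

Section KSS16.

Definition kss16_p (u : rat) : rat :=
  (u ^+ 10 + 2 * u ^+ 9 + 5 * u ^+ 8 + 48 * u ^+ 6 + 152 * u ^+ 5
   + 240 * u ^+ 4 + 625 * u ^+ 2 + 2398 * u + 3125) / 980.

(* The denominator is 61250. *)
Definition kss16_r (u : rat) : rat :=
  (u ^+ 8 + 48 * u ^+ 4 + 625) / (1225 * 50).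

Definition kss16_t (u : rat) : rat := (2 * u ^+ 5 + 41 * u + 35) / 35.

Definition embedding_degree (p r k : nat) : Prop :=
  [/\ (0 < k)%N, (r %| p ^ k - 1)%N
    & forall j : nat, (0 < j < k)%N -> ~~ (r %| p ^ j - 1)%N].

(* y^2 = x^3 + a x over F_p is a KSS curve of embedding degree 16 with
   parameter u, trace t and subgroup order r. *)
Record kss16_curve (u : int) (p r : nat) (t : int) (a : 'F_p) : Prop := {
  kss16_p_prime : prime p;
  kss16_p_gt3 : (3 < p)%N;
  kss16_r_prime : prime r;
  kss16_pE : p%:R = kss16_p u%:~R;
  kss16_rE : r%:R = kss16_r u%:~R;
  kss16_tE : t%:~R = kss16_t u%:~R;
  kss16_a_neq0 : a != 0;
  kss16_card : #|[set P : point 'F_p | on_curve a 0 P]|%:Z = p%:Z + 1 - t;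
  kss16_dvd : (r %| p%:Z + 1 - t)%Z;
  kss16_embedding : embedding_degree p r 16
}.

(* Membership in the subfield with p ^ n elements. *)
Definition in_Fpn (K : fieldType) (p n : nat) (z : K) : Prop :=
  z ^+ (p ^ n) = z.

(* eta is a nonzero element of F_{p^16}, eta^4 is in F_{p^4}, and
   (1, eta, eta^2, eta^3) is a basis of F_{p^16} over F_{p^4}. *)
Definition quartic_twist_param (K : fieldType) (p : nat) (eta : K) : Prop :=
  [/\ eta != 0, in_Fpn p 16 eta, in_Fpn p 4 (eta ^+ 4)
    & forall z : K, in_Fpn p 16 z ->
        exists! c : {ffun 'I_4 -> K},
          (forall i, in_Fpn p 4 (c i)) /\ z = \sum_(i < 4) c i * eta ^+ i].

Definition twist_coef (K : fieldType) (a eta : K) : K := eta ^- 4 * a.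

Definition twist_map (K : fieldType) (eta : K) (P : point K) : point K :=
  if P is Some (x, y) then Some (eta ^+ 2 * x, eta ^+ 3 * y) else None.

Definition optimal_ate (K : fieldType) (p r : nat) (u : int) (a : K)
    (Q P : point K) : K :=
  ((funeval (miller a 0 u Q) P * line a (mulp a u Q) (mulp a p%:Z Q) P)
     ^+ (p ^ 3) * line a Q Q P) ^+ ((p ^ 16 - 1) %/ r).

End KSS16.

(* Main.v *)
Require Import Defs.
From HB Require Import structures.
From mathcomp Require Import all_boot all_order all_algebra all_field.
From mathcomp Require classical_sets.
From mathcomp Require Import ring zify.

Set Implicit Arguments.
Unset Strict Implicit.
Unset Printing Implicit Defensive.

Import GRing.Theory.

Local Open Scope ring_scope.

(** Write Q', P' for the twisted points, w(n) = W(n,0) and v(n) = W(n,1).  The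
    final exponent is a multiple of 2 (p^8 - 1), so it kills eta and every
    nonzero element of F_{p^8} ([half_final_exp]).  The coordinates of the
    multiples of Q' lie in F_{p^4} and x_{P'} lies in F_{p^8}.  So it suffices
    to match the three factors of the pairing up to such constants.

    Miller function.  In sigma functions, v(n) is w(n) / f_{n,-Q'}(P'), and
    f_{n,Q'}(P') f_{n,-Q'}(P') depends on abscissae only.  The algebraic form
    of this is that v(n+1) / v(n) is, up to abscissae and values of w, the line
    through [n]Q' and Q' at P' ([net1_miller]); it follows by induction from a
    linear relation between w and v contained in the net equation.  The same
    line, divided by the vertical at [n+1]Q', is the step of the Miller
    recursion.  A negative index reduces to a positive one by the relation
    between v(n) and v(-n) ([net1_opp]).

    Multiples of Q'.  The Somos relation contained in the net equation gives
    w(n+1) w(n-1) = w(n)^2 (x_{Q'} - x_{[n]Q'}), hence the abscissa of [u]Q'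
    ([net0_abscissa]), and then its ordinate ([net0_ordinate]).  So l1 and l2
    are the two lines of the pairing, with denominators cleared.

    Existence of f_{u,Q}.  The function is a product of chords divided by
    verticals ([miller_fun_spec]).  A chord times its conjugate is a product of
    three verticals, which gives its divisor ([lin_divisor]).  A function
    without zeros and poles is constant ([regular_const]), so the divisor and
    the normalization determine the function ([same_divisor]).

    No denominator vanishes.  The order of Q is the prime r, u is small
    compared with r, [u]Q and [p]Q have different abscissae because u is not
    congruent to p or -p modulo r ([kss_u_neq_p]).  P' is not a multiple of Q':
    if its coordinates were in F_{p^4}, they would vanish
    ([twist_point_not_rational]), but (0,0) has order 2 and r is odd.  The orbit
    of Q under addition of Q is governed by the cancellation law [addpK]. *)

(** * Chords and the orbit of a point *)

Section Chords.

Variables (F : fieldType) (a b : F).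
Hypothesis two_neq0 : 2 != 0 :> F.
Implicit Types (x y : F) (P Q S : point F).

Definition opposite x1 y1 x2 y2 : bool := (x1 == x2) && (y1 == - y2).

Lemma addp_finite x1 y1 x2 y2 (l := slope a (x1, y1) (x2, y2)) :
  ~~ opposite x1 y1 x2 y2 ->
  addp a (Some (x1, y1)) (Some (x2, y2))
  = Some (l ^+ 2 - x1 - x2, l * (x1 - (l ^+ 2 - x1 - x2)) - y1).
Proof. by rewrite /= /opposite => /negPf ->. Qed.

Lemma curve_same_x x y1 y2 :
  on_curve a b (Some (x, y1)) -> on_curve a b (Some (x, y2)) ->
  y1 = y2 \/ y1 = - y2.
Proof.
rewrite /= => /eqP h1 /eqP h2; have: y1 ^+ 2 == y2 ^+ 2 by rewrite h1 h2.
by rewrite eqf_sqr => /orP[] /eqP; [left | right].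
Qed.

Lemma slopeP x1 y1 x2 y2 (l := slope a (x1, y1) (x2, y2)) :
  on_curve a b (Some (x1, y1)) -> on_curve a b (Some (x2, y2)) ->
  ~~ opposite x1 y1 x2 y2 ->
  y2 = y1 + l * (x2 - x1)
  /\ (x1 = x2 -> [/\ y1 = y2, y1 != 0 & 2 * y1 * l = 3 * x1 ^+ 2 + a]).
Proof.
move=> c1 c2 nop; rewrite /l /slope; case: eqP => [[ex ey]|ne].
  subst x2 y2; move: nop; rewrite /opposite eqxx /= -subr_eq0 opprK => nz.
  have y0 : y1 != 0 by apply: contraNneq nz => ->; rewrite addr0.
  split; first by ring.
  by move=> _; split=> //; field; rewrite y0.
have nx : x1 != x2.
  apply/eqP => ex; subst x2; case: (curve_same_x c1 c2) => ey.
    by case: ne; rewrite ey.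
  by move: nop; rewrite /opposite eqxx ey eqxx.
split; last by move=> e; rewrite e eqxx in nx.
by field; rewrite subr_eq0 eq_sym.
Qed.

(** The line through two points meets the curve where a cubic in x vanishes;
    its three roots are the abscissae of the two points and of their sum. *)
Lemma chord_roots x1 y1 x2 y2 (l := slope a (x1, y1) (x2, y2)) x :
  on_curve a b (Some (x1, y1)) -> on_curve a b (Some (x2, y2)) ->
  ~~ opposite x1 y1 x2 y2 ->
  x ^+ 3 + a * x + b - (y1 + l * (x - x1)) ^+ 2
  = (x - x1) * (x - x2) * (x - (l ^+ 2 - x1 - x2)).
Proof.
move=> c1 c2 nop; have [] := slopeP c1 c2 nop; rewrite -/l.
move: c1 c2 => /= /eqP c1 /eqP c2 e2 et.
have [ex|nx] := eqVneq x1 x2.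
  have [_ _ t] := et ex; rewrite -ex.
  have -> : b = y1 ^+ 2 - x1 ^+ 3 - a * x1 by rewrite c1; ring.
  have -> : a = 2 * y1 * l - 3 * x1 ^+ 2 by rewrite t; ring.
  ring.
apply: (@mulfI _ (x2 - x1)); first by rewrite subr_eq0 eq_sym.
have eb : b = y1 ^+ 2 - x1 ^+ 3 - a * x1 by rewrite c1; ring.
have ea : a * (x2 - x1) = (y1 + l * (x2 - x1)) ^+ 2 - y1 ^+ 2 - x2 ^+ 3 + x1 ^+ 3.
  by rewrite -e2 c2 c1; ring.
transitivity ((x2 - x1) * (x ^+ 3 + y1 ^+ 2 - x1 ^+ 3 - (y1 + l * (x - x1)) ^+ 2)
    + (a * (x2 - x1)) * (x - x1)).
  by rewrite eb; ring.
by rewrite ea; ring.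
Qed.

Lemma on_curve_addp P S :
  on_curve a b P -> on_curve a b S -> on_curve a b (addp a P S).
Proof.
case: P S => [[x1 y1]|] [[x2 y2]|] // c1 c2.
have [op|nop] := boolP (opposite x1 y1 x2 y2).
  by rewrite /addp -/(opposite _ _ _ _) op.
rewrite addp_finite //; set l := slope _ _ _; rewrite /=.
have /eqP := chord_roots (l ^+ 2 - x1 - x2) c1 c2 nop.
rewrite -/l subrr mulr0 subr_eq0 => /eqP ->.
by apply/eqP; ring.
Qed.

Lemma slope_sym (R S : F * F) : slope a R S = slope a S R.
Proof.
case: R S => [x1 y1] [x2 y2]; rewrite /slope (eq_sym (x2, y2)).
by case: eqP => [[-> ->]//|_]; rewrite -(opprB y1 y2) -(opprB x1 x2) mulNr invrN mulrN opprK.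
Qed.

Lemma oppp_addp P S : oppp (addp a P S) = addp a (oppp P) (oppp S).
Proof.
case: P S => [[x1 y1]|] [[x2 y2]|] //.
rewrite /oppp /addp eqr_opp; case: ifP => // _.
have -> : slope a (x1, - y1) (x2, - y2) = - slope a (x1, y1) (x2, y2).
  rewrite /slope !xpair_eqE eqr_opp; case: ifP => _.
    by rewrite mulrN invrN mulrN.
  by rewrite -opprB opprK addrC opprB -mulNr opprB.
by congr (Some (_, _)); ring.
Qed.

(** Cancellation makes the orbit of a point under its own addition cyclic, hence
    gives the multiples of Q their order.  The delicate case is a chord tangent to the curve at its first
    point: then the sum is the opposite of that point. *)
Lemma addpK x1 y1 S (Q := Some (x1, y1)) :
  y1 != 0 -> on_curve a b Q -> on_curve a b S ->
  addp a (oppp Q) (addp a Q S) = S.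
Proof.
move=> y0 c1; case: S => [[x2 y2]|] c2; last first.
  by rewrite /= opprK !eqxx.
have [op|nop] := boolP (opposite x1 y1 x2 y2).
  rewrite {2}/addp /Q -/(opposite _ _ _ _) op.
  by case/andP: op => /eqP <- /eqP ->; rewrite /= opprK.
have [e2 et] := slopeP c1 c2 nop.
have cr := chord_roots _ c1 c2 nop.
rewrite /Q addp_finite //; move: (slope a _ _) e2 et cr => l e2 et cr.
set x3 := l ^+ 2 - _ - _; set y3 := l * _ - _.
have [e3|n3] := eqVneq x3 x1.
  have ey : y3 = - y1 by rewrite /y3 e3; ring.
  have ll : l ^+ 2 = 2 * x1 + x2.
    have -> : l ^+ 2 = x3 + x1 + x2 by rewrite /x3; ring.
    by rewrite e3; ring.
  have tg : 2 * y1 * l = 3 * x1 ^+ 2 + a.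
    have [ex|nx] := eqVneq x1 x2; first by have [_ _ ->] := et ex.
    apply: (@mulfI _ (x2 - x1)); first by rewrite subr_eq0 eq_sym.
    move: c1 c2 => /= /eqP c1 /eqP c2.
    transitivity (y2 ^+ 2 - y1 ^+ 2 - l ^+ 2 * (x2 - x1) ^+ 2); first by rewrite e2; ring.
    by rewrite c1 c2 ll; ring.
  have sl : slope a (x1, - y1) (x1, - y1) = - l.
    by rewrite /slope eqxx -tg; field; rewrite oppr_eq0 y0.
  rewrite e3 ey /oppp addp_finite ?sl.
    congr (Some (_, _)); first by rewrite sqrrN ll; ring.
    by rewrite e2 sqrrN ll; ring.
  rewrite /opposite eqxx /= opprK -subr_eq0 -opprD oppr_eq0.
  by rewrite -mulr2n -mulr_natl mulf_neq0.
have sl : slope a (x1, - y1) (x3, y3) = - l.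
  rewrite /slope xpair_eqE (eq_sym x1) (negPf n3) /= /y3.
  by field; rewrite subr_eq0.
rewrite /oppp addp_finite ?sl.
  by congr (Some (_, _)); rewrite ?e2 /x3; ring.
by rewrite /opposite eq_sym (negPf n3).
Qed.

End Chords.

Section Orbit.

Variables (F : fieldType) (a b : F) (x1 y1 : F).
Hypothesis two_neq0 : 2 != 0 :> F.
Let Q : point F := Some (x1, y1).
Hypothesis Q_on : on_curve a b Q.

Definition smul n : point F := iter n (addp a Q) None.

Lemma smulS n : smul n.+1 = addp a Q (smul n).
Proof. by []. Qed.

Lemma smulD m n : smul (m + n) = iter m (addp a Q) (smul n).
Proof. by rewrite /smul iterD. Qed.

Lemma smul_on n : on_curve a b (smul n).
Proof. by elim: n => // n IH; rewrite smulS on_curve_addp. Qed.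

Lemma iter_addQ_on n P :
  on_curve a b P -> on_curve a b (iter n (addp a Q) P).
Proof. by move=> cP; elim: n => // n IH; rewrite iterS on_curve_addp. Qed.

Lemma smul_order2 n : y1 = 0 -> smul n = if odd n then Q else None.
Proof.
move=> y0; elim: n => // n IH; rewrite smulS IH /Q y0.
by rewrite [odd _.+1]/=; case: odd; rewrite //= oppr0 !eqxx.
Qed.

Variable r : nat.
Hypotheses (r_prime : prime r) (r_odd : odd r) (smul_r : smul r = None).

Lemma base_y_neq0 : y1 != 0.
Proof. by apply/eqP => /(smul_order2 r); rewrite smul_r r_odd. Qed.

Let addQK S : on_curve a b S -> addp a (oppp Q) (addp a Q S) = S.
Proof. exact: addpK base_y_neq0 Q_on. Qed.

Lemma smul_addI S T : on_curve a b S -> on_curve a b T ->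
  addp a Q S = addp a Q T -> S = T.
Proof. by move=> cS cT e; rewrite -(addQK cS) e addQK. Qed.

Lemma iter_addI n S T : on_curve a b S -> on_curve a b T ->
  iter n (addp a Q) S = iter n (addp a Q) T -> S = T.
Proof.
move=> cS cT; elim: n => // n IH; rewrite !iterS => e; apply: IH; apply: smul_addI e.
  exact: iter_addQ_on.
exact: iter_addQ_on.
Qed.

Lemma smul_sub m n : smul m = smul (n + m) -> smul n = None.
Proof.
rewrite addnC -[in LHS](addn0 m) !smulD => e; apply/esym.
by apply: iter_addI e; rewrite ?smul_on.
Qed.

Lemma smul_mul m n : smul n = None -> smul (m * n) = None.
Proof. by move=> e; elim: m => // m IH; rewrite mulSn addnC smulD e. Qed.

Lemma smul_eq0 n : smul n = None -> (r %| n)%N.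
Proof.
move=> e; apply: contraT => nd.
have /eqP cop : coprime r n by rewrite prime_coprime.
have r0 := prime_gt0 r_prime.
have [km kn def _] := egcdnP n r0.
have : smul (gcdn r n) = None.
  apply: (@smul_sub (kn * n)); rewrite addnC -def smul_mul //.
  by rewrite smul_mul.
by rewrite cop.
Qed.

Lemma smul_inj m n : smul m = smul n -> m = n %[mod r].
Proof.
wlog le : m n / (m <= n)%N.
  by case/orP: (leq_total m n) => le H e; [apply: H | apply/esym/H].
rewrite -{1}(subnK le) => /smul_sub /smul_eq0 d.
by apply/eqP; rewrite eq_sym eqn_mod_dvd.
Qed.

Lemma smul_mod n : smul n = smul (n %% r).
Proof.
by rewrite {1}(divn_eq n r) addnC smulD smul_mul // -[RHS]/(iter _ _ _).
Qed.

(** O is obtained from [r - n]Q by n additions of Q, and n additions of -Q undo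
    them. *)
Lemma smul_opp n : (n <= r)%N -> oppp (smul n) = smul (r - n).
Proof.
move=> le; have eN : forall m, oppp (smul m) = iter m (addp a (oppp Q)) None.
  by elim=> // m IH; rewrite smulS oppp_addp IH.
have : forall m S, on_curve a b S ->
    iter m (addp a (oppp Q)) (iter m (addp a Q) S) = S.
  elim=> // m IH S cS; rewrite iterSr iterS addQK ?IH //.
  exact: iter_addQ_on.
move=> /(_ n _ (smul_on (r - n))).
by rewrite -smulD subnKC // smul_r eN.
Qed.

Definition independent (P : point F) := forall n, P <> smul n.

(** A point outside the orbit never shares an abscissa with the orbit, since the
    orbit is closed under opposite. *)
Lemma independent_abscissa x y n xn yn :
  on_curve a b (Some (x, y)) -> independent (Some (x, y)) ->
  smul n = Some (xn, yn) -> x != xn.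
Proof.
move=> cP iP e; apply/eqP => ex; subst x.
have cn := smul_on n; rewrite e in cn.
case: (curve_same_x cP cn) => ey.
  by apply: (iP n); rewrite e ey.
apply: (iP (r - n %% r)%N).
rewrite -smul_opp; last by rewrite ltnW // ltn_mod prime_gt0.
by rewrite -smul_mod e /= ey.
Qed.

Lemma smul_finite n : ~~ (r %| n)%N -> exists xy, smul n = Some xy.
Proof.
move=> nd; case e : (smul n) => [xy|]; first by exists xy.
by move/smul_eq0: e nd => ->.
Qed.

Lemma smul_abscissa m n xm ym xn yn :
  smul m = Some (xm, ym) -> smul n = Some (xn, yn) -> xm = xn ->
  m = n %[mod r] \/ m + n = 0 %[mod r].
Proof.
move=> em en ex; subst xm.
have cm := smul_on m; have cn := smul_on n; rewrite em in cm; rewrite en in cn.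
case: (curve_same_x cm cn) => ey.
  by left; apply: smul_inj; rewrite em en ey.
right; have r0 := prime_gt0 r_prime.
have lt : (n %% r <= r)%N by rewrite ltnW // ltn_mod.
have : smul m = smul (r - n %% r) by rewrite -smul_opp // -smul_mod en /= em ey.
move/smul_inj => e; rewrite -modnDm e modnDm.
by rewrite -[in LHS]modnDmr subnK // modnn mod0n.
Qed.

Lemma smul_y_neq0 n xn yn : smul n = Some (xn, yn) -> yn != 0.
Proof.
move=> e; apply/eqP => y0.
have r0 := prime_gt0 r_prime.
have lt : (n %% r <= r)%N by rewrite ltnW // ltn_mod.
have : smul (n %% r)%N = smul (r - n %% r)%N.
  by rewrite -smul_opp // -smul_mod e y0 /= oppr0.
move/smul_inj => ee.
have : (r %| (n %% r).*2)%N.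
  rewrite /dvdn -addnn; move: (n %% r)%N lt ee => k lt ee.
  by rewrite -modnDmr ee modnDmr subnKC // modnn.
rewrite -muln2 Gauss_dvdl; last by rewrite coprimen2.
rewrite /dvdn modn_mod => /eqP nr.
by move: e; rewrite smul_mod nr.
Qed.

End Orbit.

(** * Elliptic nets *)

Section Net.

Variables (K : fieldType) (a b x1 y1 x2 y2 : K) (W : int * int -> K).
Hypothesis two_neq0 : 2 != 0 :> K.
Hypothesis hW : stange_net a b (x1, y1) (x2, y2) W.
Let Q : point K := Some (x1, y1).
Let P : point K := Some (x2, y2).
Let psi3 := 3 * x1 ^+ 4 + 6 * a * x1 ^+ 2 + 12 * b * x1 - a ^+ 2.

Lemma stange_net_opp m n : W (- m, - n) = - W (m, n).
Proof. by have [_ [_ [h _]]] := hW; rewrite -h. Qed.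

(** The net equation at (m,j), (2,0), (1,0), 0. *)
Lemma stange_net_somos m j :
  W (m + 2, j) * W (m - 2, j)
  = 4 * y1 ^+ 2 * (W (m + 1, j) * W (m - 1, j)) - psi3 * W (m, j) ^+ 2.
Proof.
have [h [_ [hN [h10 [_ [_ [h20 [h30 _]]]]]]]] := hW.
have := h (m, j) (2, 0) (1, 0) 0.
rewrite !addr0 /= -[(m, j) + (2, 0)]/(m + 2, j + 0) -[(m, j) - (2, 0)]/(m - 2, j - 0).
rewrite -[(1, 0) + (m, j)]/(1 + m, 0 + j) -[(1, 0) - (m, j)]/(1 - m, 0 - j).
rewrite -[(2, 0) + (1, 0)]/(3, 0) -[(2, 0) - (1, 0)]/(1, 0).
have -> : W (1 - m, 0 - j) = - W (m - 1, j).
  by rewrite -stange_net_opp opprB sub0r.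
rewrite h10 h20 h30 ?addr0 ?subr0 ?add0r [1 + m]addrC -/psi3.
move/eqP; rewrite -subr_eq0 => /eqP e; apply/eqP; rewrite -subr_eq0; apply/eqP.
by rewrite -[RHS]e; ring.
Qed.

(** The net equation at (m,0), (1,0), (-1,0), (0,1). *)
Lemma stange_net_linear m :
  W (m + 1, 1) * W (m - 1, 0) * (x1 - x2)
  = 2 * y1 * W (m, 0) * W (m, 1) - W (m + 1, 0) * W (m - 1, 1).
Proof.
have [h [_ [hN [h10 [h01 [h11 [h20 [h30 [_ [_ [hm1 _]]]]]]]]]]] := hW.
have := h (m, 0) (1, 0) (-1, 0) (0, 1).
rewrite -[(m, 0) + (1, 0) + (0, 1)]/(m + 1 + 0, 0 + 0 + 1).
rewrite -[(m, 0) - (1, 0)]/(m - 1, 0 - 0) -[(-1, 0) + (0, 1)]/(-1 + 0, 0 + 1).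
rewrite -[(1, 0) + (-1, 0) + (0, 1)]/(0, 1) -[(1, 0) - (-1, 0)]/(2, 0).
rewrite -[(m, 0) + (0, 1)]/(m + 0, 0 + 1).
rewrite -[(-1, 0) + (m, 0) + (0, 1)]/(-1 + m + 0, 0 + 0 + 1).
rewrite -[(-1, 0) - (m, 0)]/(-1 - m, 0 - 0) -[(1, 0) + (0, 1)]/(1, 1).
rewrite ?subr0 ?addr0 ?add0r.
have -> : W (-1, 0) = - W (1, 0) by rewrite -stange_net_opp oppr0.
have -> : W (-1 - m, 0) = - W (m + 1, 0).
  by rewrite -stange_net_opp opprD addrC oppr0.
rewrite hm1 h10 h20 h01 h11 [-1 + m]addrC.
move=> e; apply/eqP; rewrite -subr_eq0; apply/eqP.
by rewrite -[RHS]oppr0 -[in RHS]e; ring.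
Qed.

(** The net equation at (m,0), (0,1), (1,0), 0. *)
Lemma stange_net_symmetric m :
  W (m, 1) * W (- m, 1)
  = (x1 - x2) * W (m, 0) ^+ 2 - W (m + 1, 0) * W (m - 1, 0).
Proof.
have [h [_ [hN [h10 [h01 [h11 [h20 [h30 [_ [_ [hm1 _]]]]]]]]]]] := hW.
have := h (m, 0) (0, 1) (1, 0) 0.
rewrite !addr0 -[(m, 0) + (0, 1)]/(m + 0, 0 + 1) -[(m, 0) - (0, 1)]/(m - 0, 0 - 1).
rewrite -[(0, 1) + (1, 0)]/(1, 1) -[(0, 1) - (1, 0)]/(-1, 1).
rewrite -[(1, 0) + (m, 0)]/(1 + m, 0) -[(1, 0) - (m, 0)]/(1 - m, 0 - 0).
rewrite ?addr0 ?add0r ?subr0.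
have -> : W (m, -1) = - W (- m, 1) by rewrite -stange_net_opp opprK.
have -> : W (1 - m, 0) = - W (m - 1, 0).
  by rewrite -stange_net_opp opprB oppr0.
rewrite [1 + m]addrC h10 h01 h11 hm1.
move=> e; apply/eqP; rewrite -subr_eq0; apply/eqP.
by rewrite -[RHS]oppr0 -[in RHS]e; ring.
Qed.

Hypothesis Q_on : on_curve a b Q.
Local Notation smul := (smul a x1 y1).
Local Notation w n := (W (n, 0)).

Let cQ : b = y1 ^+ 2 - x1 ^+ 3 - a * x1.
Proof. by move/eqP: Q_on => ->; ring. Qed.

Lemma chord_coef_a xA yA : on_curve a b (Some (xA, yA)) ->
  a * (xA - x1) = yA ^+ 2 - y1 ^+ 2 - xA ^+ 3 + x1 ^+ 3.
Proof. by move=> /eqP ->; rewrite cQ; ring. Qed.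

Lemma slope_chord xA yA yB : xA != x1 ->
  slope a (x1, yB) (xA, yA) = (yA - yB) / (xA - x1).
Proof. by move=> nx; rewrite /slope xpair_eqE eq_sym (negPf nx). Qed.

Lemma addp_chord xA yA yB xC yC :
  xA != x1 -> addp a (Some (x1, yB)) (Some (xA, yA)) = Some (xC, yC) ->
  xC = ((yA - yB) / (xA - x1)) ^+ 2 - x1 - xA.
Proof.
move=> nx; rewrite addp_finite; first by rewrite slope_chord // => -[<- _].
by rewrite /opposite eq_sym (negPf nx).
Qed.

Hypothesis y1_neq0 : y1 != 0.

Lemma chord_sum_diff xA yA xB yB xC yC :
  on_curve a b (Some (xA, yA)) -> on_curve a b (Some (xB, yB)) -> xA != x1 ->
  addp a Q (Some (xB, yB)) = Some (xA, yA) ->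
  addp a Q (Some (xA, yA)) = Some (xC, yC) ->
  xB = ((yA + y1) / (xA - x1)) ^+ 2 - x1 - xA
  /\ xC = ((yA - y1) / (xA - x1)) ^+ 2 - x1 - xA.
Proof.
move=> cA cB nx eA eC; split; last exact: addp_chord eC.
have := addpK two_neq0 y1_neq0 Q_on cB; rewrite eA => eB.
by rewrite -[y1 in RHS]opprK; exact: addp_chord eB.
Qed.

(** For A = Q + B and C = Q + A, the points C and B are the sums of A with Q and
    with -Q, so their abscissae are rational functions of the coordinates of A
    and Q, in which the coefficients of the curve can be eliminated. *)
Lemma chord_somos xA yA xB yB xC yC :
  on_curve a b (Some (xA, yA)) -> on_curve a b (Some (xB, yB)) -> xA != x1 ->
  addp a Q (Some (xB, yB)) = Some (xA, yA) ->
  addp a Q (Some (xA, yA)) = Some (xC, yC) ->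
  (x1 - xC) * (x1 - xB) * (x1 - xA) ^+ 2 = 4 * y1 ^+ 2 * (x1 - xA) - psi3.
Proof.
move=> cA cB nx eA eC; have [-> ->] := chord_sum_diff cA cB nx eA eC.
have nx' : xA - x1 != 0 by rewrite subr_eq0.
have ea : a = (yA ^+ 2 - y1 ^+ 2 - xA ^+ 3 + x1 ^+ 3) / (xA - x1).
  by rewrite -(chord_coef_a cA) mulfK.
by rewrite /psi3 cQ ea; field.
Qed.

Lemma chord_ordinate xA yA xB yB xC yC :
  on_curve a b (Some (xA, yA)) -> on_curve a b (Some (xB, yB)) -> xA != x1 ->
  addp a Q (Some (xB, yB)) = Some (xA, yA) ->
  addp a Q (Some (xA, yA)) = Some (xC, yC) ->
  (x1 - xA) ^+ 2 * (xB - xC) = 4 * y1 * yA.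
Proof.
move=> cA cB nx eA eC; have [-> ->] := chord_sum_diff cA cB nx eA eC.
by field; rewrite subr_eq0.
Qed.

Lemma psi3_double x y :
  smul 2 = Some (x, y) -> psi3 = 4 * y1 ^+ 2 * (x1 - x).
Proof.
rewrite -[smul 2]/(addp a Q Q) /Q addp_finite; last first.
  rewrite /opposite eqxx /= -subr_eq0 opprK -mulr2n -mulr_natl.
  by rewrite mulf_neq0.
rewrite /slope eqxx => -[<- _]; rewrite /psi3 cQ.
by field; rewrite y1_neq0.
Qed.

Lemma psi4_triple x y xT yT : x != x1 ->
  smul 2 = Some (x, y) -> smul 3 = Some (xT, yT) ->
  W (4, 0) * W (2, 0) = psi3 ^+ 2 * (x1 - xT).
Proof.
move=> nx e2; rewrite smulS e2 => /(addp_chord nx) ->.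
rewrite (psi3_double e2); move: e2; rewrite -[smul 2]/(addp a Q Q) /Q addp_finite; last first.
  rewrite /opposite eqxx /= -subr_eq0 opprK -mulr2n -mulr_natl.
  by rewrite mulf_neq0.
set l := slope _ _ _; have tg : 2 * y1 * l = 3 * x1 ^+ 2 + a.
  by rewrite /l /slope eqxx; field; rewrite y1_neq0.
have ea : a = 2 * y1 * l - 3 * x1 ^+ 2 by rewrite tg; ring.
have [_ [_ [_ [_ [_ [_ [-> [_ [-> _]]]]]]]]] := hW.
move: nx => /[swap] -[<- <-]; rewrite -subr_eq0 => nx.
by rewrite cQ ea; field.
Qed.

Variable r : nat.
Hypotheses (r_prime : prime r) (r_odd : odd r) (smul_r : smul r = None).

Lemma smul_lt_finite n : (0 < n < r)%N -> exists xy, smul n = Some xy.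
Proof.
case/andP=> n0 nr; apply: (smul_finite two_neq0 Q_on r_prime r_odd) => //.
by apply/negP => /(dvdn_leq n0); rewrite leqNgt nr.
Qed.

Lemma smul_lt_abscissa n x y :
  (1 < n)%N -> (n.+1 < r)%N -> smul n = Some (x, y) -> x != x1.
Proof.
move=> n1 nr e; apply/eqP => ex; subst x.
have e1 : smul 1 = Some (x1, y1) by [].
have nr' := ltnW nr.
case: (smul_abscissa two_neq0 Q_on r_prime r_odd smul_r e e1 (erefl _)).
  by rewrite !modn_small ?prime_gt1 // => h; rewrite h in n1.
by rewrite addn1 mod0n modn_small.
Qed.

Definition net0 n := W (Posz n, 0).

Lemma net0_somos n :
  net0 n.+4 * net0 n = 4 * y1 ^+ 2 * (net0 n.+3 * net0 n.+1) - psi3 * net0 n.+2 ^+ 2.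
Proof.
have := stange_net_somos n.+2 0; rewrite /net0.
have -> : Posz n.+2 + 2 = Posz n.+4 by lia.
have -> : Posz n.+2 - 2 = Posz n by lia.
have -> : Posz n.+2 + 1 = Posz n.+3 by lia.
by have -> : Posz n.+2 - 1 = Posz n.+1 by lia.
Qed.

(** This is the Somos relation solved: the quotients w(n+1) w(n-1) / w(n)^2 and
    the differences x1 - x([n]Q) obey the same second order recurrence. *)
Lemma net0_abscissa n x y : (n.+3 < r)%N -> smul n.+2 = Some (x, y) ->
  [/\ net0 n.+1 != 0, net0 n.+2 != 0
    & net0 n.+3 * net0 n.+1 = net0 n.+2 ^+ 2 * (x1 - x)].
Proof.
have fin m : (m.+3 < r)%N -> exists x y,
    [/\ smul m.+2 = Some (x, y), on_curve a b (Some (x, y)) & x != x1].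
  move=> mr; have [|[x' y'] e] := smul_lt_finite (n := m.+2).
    by rewrite (ltn_trans _ mr).
  exists x', y'; split=> //; first by rewrite -e smul_on.
  by apply: smul_lt_abscissa e.
have next (g0 g1 g2 e0 : K) : g2 * g0 = g1 ^+ 2 * e0 -> g1 != 0 -> e0 != 0 ->
    g2 != 0.
  move=> e g10 e00; apply: contraTneq (eqxx g2) => z.
  by move/eqP: e; rewrite z mul0r eq_sym mulf_eq0 expf_eq0 (negPf g10) (negPf e00).
have solve (g0 g1 g2 g3 g4 e0 e1 e2 c s : K) : g0 != 0 -> g1 != 0 ->
    g2 * g0 = g1 ^+ 2 * e0 -> g3 * g1 = g2 ^+ 2 * e1 ->
    e2 * e0 * e1 ^+ 2 = c * e1 - s ->
    g4 * g0 = c * (g3 * g1) - s * g2 ^+ 2 -> g4 * g2 = g3 ^+ 2 * e2.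
  move=> g00 g10 h0 h1 he h4.
  apply: (@mulfI _ (g0 * g1 ^+ 2)); first by rewrite mulf_neq0 // expf_neq0.
  transitivity (g1 ^+ 2 * g2 * (g4 * g0)); first by ring.
  rewrite h4 h1.
  transitivity (g1 ^+ 2 * g2 ^+ 3 * (c * e1 - s)); first by ring.
  rewrite -he.
  transitivity (g2 ^+ 3 * e1 ^+ 2 * (g1 ^+ 2 * e0) * e2); first by ring.
  rewrite -h0.
  transitivity (g0 * (g2 ^+ 2 * e1) ^+ 2 * e2); first by ring.
  by rewrite -h1; ring.
have [_ [w0 [_ [w1 [_ [_ [w2 [w3 _]]]]]]]] := hW.
suff main : forall m, (m.+4 < r)%N -> [/\ net0 m.+1 != 0, net0 m.+2 != 0,
    (forall x y, smul m.+2 = Some (x, y) ->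
       net0 m.+3 * net0 m.+1 = net0 m.+2 ^+ 2 * (x1 - x))
  & (forall x y, smul m.+3 = Some (x, y) ->
       net0 m.+4 * net0 m.+2 = net0 m.+3 ^+ 2 * (x1 - x))].
  case: n => [|n] nr e; last first.
    have [wa wb wc wd] := main n nr; split=> //; last exact: wd e.
    have [x' [y' [e' _ nx]]] := fin n (ltnW nr).
    by apply: next (wc _ _ e') _ _ => //; rewrite subr_eq0 eq_sym.
  rewrite /net0 w1 w2 w3 -/psi3 (psi3_double e) oner_neq0 (mulf_neq0 two_neq0) //.
  by split=> //; ring.
elim=> [|m IH] mr.
  have [x' [y' [e' _ nx]]] := fin 0%N (ltnW mr).
  rewrite /net0 w1 w2 w3 -/psi3 oner_neq0 (mulf_neq0 two_neq0) //; split=> // [? ? e|? ? e].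
    by rewrite (psi3_double e); ring.
  by rewrite -w2 (psi4_triple nx e' e).
have [wa wb wc wd] := IH (ltnW mr).
have [xB [yB [eB cB nB]]] := fin m (ltnW (ltnW mr)).
have [xA [yA [eA cA nA]]] := fin m.+1 (ltnW mr).
have hc := wc _ _ eB; have hd := wd _ _ eA.
split=> //.
  by apply: next hc _ _ => //; rewrite subr_eq0 eq_sym.
move=> xC yC eC.
apply: (solve _ _ _ _ _ _ _ _ _ _ wa wb hc hd _ (net0_somos m.+1)).
by rewrite (chord_somos cA cB nA (yC := yC)) // -/Q -?eA -?eB -?eC.
Qed.

(** 4 y1 y = (y + y1)^2 - (y - y1)^2 is (x1 - x)^2 times the difference of the
    abscissae of the two neighbouring multiples of Q, which [net0_abscissa]
    expresses by the net. *)
Lemma net0_ordinate n x y : (n.+4.+1 < r)%N -> smul n.+3 = Some (x, y) ->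
  4 * y1 * y * net0 n.+3 ^+ 3
  = net0 n.+2 ^+ 2 * net0 n.+4.+1 - net0 n.+4 ^+ 2 * net0 n.+1.
Proof.
move=> nr e; have nr1 := ltnW nr; have nr2 := ltnW nr1.
have [|[xB yB] eB] := smul_lt_finite (n := n.+2); first exact: ltnW.
have [|[xC yC] eC] := smul_lt_finite (n := n.+4); first exact: nr1.
have [_ g2 hB] := net0_abscissa nr2 eB.
have [_ g3 hA] := net0_abscissa nr1 e.
have [_ _ hC] := net0_abscissa nr eC.
have nx : x != x1 by apply: smul_lt_abscissa e.
have on m : on_curve a b (smul m) by exact: smul_on.
rewrite -(chord_ordinate (xA := x) (xB := xB) (xC := xC) (yB := yB) (yC := yC)) ?nx //;
  try by rewrite -?e -?eB -?eC.
move: (net0 n.+1) (net0 n.+2) (net0 n.+3) (net0 n.+4) (net0 n.+4.+1) g3 hA hB hC.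
move=> h1 h2 h3 h4 h5 g3 hA hB hC; apply: (mulfI g3).
transitivity ((h3 ^+ 2 * (x1 - x)) ^+ 2 * (xB - xC)); first by ring.
rewrite -hA; transitivity (h2 ^+ 2 * (h5 * h3) - h4 ^+ 2 * (h3 * h1)); last by ring.
by rewrite hB hC; ring.
Qed.

Hypothesis P_on : on_curve a b P.
Hypothesis P_indep : independent a x1 y1 P.

(** The second factor is, up to sign, the line through S and Q at -P. *)
Lemma line_conj xS yS xT yT (l := slope a (x1, y1) (xS, yS)) :
  on_curve a b (Some (xS, yS)) ->
  addp a Q (Some (xS, yS)) = Some (xT, yT) ->
  [/\ yT = l * (x1 - xT) - y1, line a (Some (xS, yS)) Q P = y2 - y1 - l * (x2 - x1)
    & line a (Some (xS, yS)) Q P * (y2 + y1 + l * (x2 - x1))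
      = (x2 - x1) * (x2 - xS) * (x2 - xT)].
Proof.
move=> cS eT.
have nop : ~~ opposite x1 y1 xS yS.
  by apply/negP => op; move: eT; rewrite /Q /addp -/(opposite _ _ _ _) op.
have [eS _] := slopeP two_neq0 Q_on cS nop.
have cr := chord_roots two_neq0 x2 Q_on cS nop.
move: eT; rewrite addp_finite // -/l => -[ex ey]; rewrite ex in ey cr.
rewrite -/l in eS cr.
have eL : line a (Some (xS, yS)) Q P = y2 - y1 - l * (x2 - x1).
  rewrite /line /Q /P slope_sym -/l.
  by clear -eS; move: l eS => k ->; ring.
split; [by rewrite -ey | by [] |]; rewrite eL -cr.
by move/eqP: P_on => <-; ring.
Qed.

Definition net1 n := W (Posz n, 1).

(** The linear relation gives each quotient of consecutive values of net1 from
    the preceding one.  The induction closes because, for T a multiple of Q, the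
    lines through T, -Q and through T, Q differ at P by a multiple of the
    vertical through T; the former appears as the conjugate of the line through
    T - Q and Q. *)
Lemma net1_miller n x y : (n.+2 < r)%N -> smul n.+1 = Some (x, y) ->
  [/\ net1 n.+1 != 0, line a (smul n.+1) Q P != 0
    & net1 n.+2 * net0 n.+1 * (x2 - x) * (x2 - x1)
      = net0 n.+2 * line a (smul n.+1) Q P * net1 n.+1].
Proof.
have nP m xm ym : smul m = Some (xm, ym) -> x2 - xm != 0.
  by move=> e; rewrite subr_eq0 (independent_abscissa two_neq0 Q_on r_prime r_odd smul_r P_on P_indep e).
have nP1 : x2 - x1 != 0 by apply: (nP 1%N).
have [_ [w0 [_ [w1 [_ [v1 [w2 [_ [_ [v2 _]]]]]]]]]] := hW.
have on m : on_curve a b (smul m) by exact: smul_on.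
have nz m z t : (m.+2 < r)%N -> smul m.+1 = Some (z, t) ->
    line a (smul m.+1) Q P != 0.
  move=> mr e; have [|[xT yT] eT] := smul_lt_finite (n := m.+2); first by [].
  move: eT; rewrite smulS e => eT.
  have [] := line_conj _ eT; first by rewrite -e.
  move=> _ _ ee; apply: contraTneq (eqxx (x2 - x1)) => z0; move/esym/eqP: ee.
  rewrite z0 mul0r !mulf_eq0 (negPf nP1) (negPf (nP _ _ _ e)) /=.
  by rewrite -e -smulS in eT; rewrite (negPf (nP _ _ _ eT)).
elim: n x y => [|n IH] x y nr e.
  split; [by rewrite /net1 v1 oner_neq0 | exact: nz e |].
  have [<- _] : Some (x1, y1) = Some (x, y) by [].
  rewrite -[smul 1]/Q /net1 /net0 v1 v2 w1 w2 /line /Q /P /slope eqxx.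
  move/eqP: P_on; rewrite cQ => eP; move: nP1 => /[dup]; rewrite {1}subr_eq0 eq_sym => nx nP1.
  apply: (@mulfI _ 1); first exact: oner_neq0.
  rewrite mulr1; transitivity ((2 * x1 + x2) * (x2 - x1) ^+ 2 - (y2 ^+ 2 - y1 ^+ 2 - 2 * y1 * (y2 - y1))).
    by field.
  by rewrite eP; field; rewrite y1_neq0.
have [|[xS yS] eS] := smul_lt_finite (n := n.+1); first exact: ltnW (ltnW nr).
have [v_neq0 l_neq0 ih] := IH _ _ (ltnW nr) eS.
have [w1_neq0 w2_neq0 hw] := net0_abscissa nr e.
have nx : x != x1 by apply: smul_lt_abscissa e.
have lT_neq0 := nz _ _ _ nr e.
have nS := nP _ _ _ eS; have nT := nP _ _ _ e.
have v2_neq0 : net1 n.+2 != 0.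
  apply: contraTneq (eqxx (x2 - x1)) => z; move/esym/eqP: ih; rewrite z !mul0r.
  by rewrite !mulf_eq0 (negPf w2_neq0) (negPf v_neq0) (negPf l_neq0).
split=> //.
have lin : net1 n.+3 * net0 n.+1 * (x1 - x2)
    = 2 * y1 * net0 n.+2 * net1 n.+2 - net0 n.+3 * net1 n.+1.
  have := stange_net_linear n.+2.
  have -> : Posz n.+2 + 1 = Posz n.+3 by rewrite -PoszD addn1.
  by have -> : Posz n.+2 - 1 = Posz n.+1 by rewrite intS addrC addKr.
have eT := e; rewrite smulS eS in eT.
have [|yT eL] := line_conj _ eT; first by rewrite -eS.
rewrite -eS => con.
have eLT : (x1 - x) * ((y2 + y1 + slope a (x1, y1) (xS, yS) * (x2 - x1))
    - line a (smul n.+2) Q P) = 2 * y1 * (x2 - x).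
  rewrite e /line /Q /P [slope a (x, y) _]slope_sym (slope_chord y y1 nx).
  move: (slope a _ _) yT => l yT.
  by rewrite yT; field; rewrite subr_eq0 nx.
have lS_neq0 : line a (Some (xS, yS)) Q P != 0 by rewrite -eS.
rewrite eS in ih con.
move: (y2 + y1 + _) (line a (Some (xS, yS)) Q P) (line a (smul n.+2) Q P) con eLT ih lS_neq0 {lT_neq0 l_neq0}.
move=> l' lS lT con eLT ih lS_neq0.
move: (net0 n.+1) (net0 n.+2) (net0 n.+3) (net1 n.+1) (net1 n.+2) (net1 n.+3)
  w1_neq0 lin hw ih {w2_neq0 v2_neq0 v_neq0} => c1 c2 c3 d1 d2 d3 c1_neq0 lin hw ih.
apply: (@mulfI _ (c1 * lS)); first by rewrite mulf_neq0.
transitivity ((c3 * c1) * (lS * lT * d2)); last by ring.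
transitivity (- (d3 * c1 * (x1 - x2)) * c2 * (x2 - x) * lS); first by ring.
rewrite lin.
transitivity (c3 * (x2 - x) * (c2 * lS * d1)
              - c2 ^+ 2 * d2 * lS * (2 * y1 * (x2 - x))); first by ring.
rewrite -ih -eLT.
transitivity ((c3 * c1) * d2 * ((x2 - x1) * (x2 - xS) * (x2 - x))
              - c2 ^+ 2 * d2 * lS * ((x1 - x) * (l' - lT))); first by ring.
by rewrite -con hw; ring.
Qed.

Lemma net1_opp n x y : (n.+2 < r)%N -> smul n.+1 = Some (x, y) ->
  net1 n.+1 * W (- Posz n.+1, 1) = net0 n.+1 ^+ 2 * (x - x2).
Proof.
have [_ [w0 [_ [w1 [_ [v1 [w2 [_ [_ [v2 _]]]]]]]]]] := hW.
move=> nr e; rewrite /net1 stange_net_symmetric.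
case: n nr e => [|n] nr e.
  have [<- _] : Some (x1, y1) = Some (x, y) by [].
  by rewrite /net0 subrr w0 mulr0 subr0; ring.
have -> : Posz n.+2 + 1 = Posz n.+3 by rewrite -PoszD addn1.
have -> : Posz n.+2 - 1 = Posz n.+1 by rewrite intS addrC addKr.
have [_ _] := net0_abscissa nr e; rewrite /net0 => ->.
by ring.
Qed.

End Net.

(** * Values of functions on the curve *)

Section Place.

Variables (K L : fieldType) (i : {rmorphism K -> L}) (X Y : L) (x y : K).
Implicit Types (f g : L) (c d : K) (s t : {poly {poly K}}).

Local Notation ev s := (map_poly (map_poly i) s).[X, Y].

(** A relation between functions and values is checked on a polynomial
    expression by checking it on constants, coordinates, sums and products. *)
Lemma ev_ind (R : L -> K -> Prop) s :
  (forall c, R (i c) c) -> R X x -> R Y y ->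
  (forall f g c d, R f c -> R g d -> R (f + g) (c + d)) ->
  (forall f g c d, R f c -> R g d -> R (f * g) (c * d)) ->
  R (ev s) s.[x, y].
Proof.
move=> RC RX RY RD RM.
have R1 (q : {poly K}) : R (map_poly i q).[Y] q.[y].
  elim/poly_ind: q => [|q c IH].
    by rewrite rmorph0 !horner0 -(rmorph0 i).
  rewrite rmorphD rmorphM /= map_polyX map_polyC !hornerE.
  by apply: (RD); [apply: (RM) | apply: (RC)].
elim/poly_ind: s => [|s q IH].
  by rewrite rmorph0 !horner0 -(rmorph0 i).
rewrite rmorphD rmorphM /= map_polyX map_polyC !hornerE.
by apply: (RD); [apply: (RM) | apply: (R1)].
Qed.

(** Stated for arbitrary coordinate functions X, Y and their values x, y, so
    that the finite points and the point at infinity are treated alike. *)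
Definition place f c := exists s t,
  [/\ t.[x, y] != 0, f = ev s / ev t & c = s.[x, y] / t.[x, y]].

Lemma place_ev s : place (ev s) s.[x, y].
Proof.
by exists s, 1; rewrite !rmorph1 /= -!polyC1 !hornerC oner_neq0 !divr1; split.
Qed.

Lemma placeC c : place (i c) c.
Proof.
have := place_ev c%:P%:P.
by rewrite map_polyC /= !hornerC map_polyC /= hornerC.
Qed.

Lemma place_fst : place X x.
Proof. by have := place_ev 'X; rewrite map_polyX /= !hornerE. Qed.

Lemma place_snd : place Y y.
Proof. by have := place_ev 'X%:P; rewrite map_polyC /= map_polyX !hornerE. Qed.

Hypothesis ev_eq0 : forall s, ev s = 0 -> s.[x, y] = 0.

Let ev_neq0 s : s.[x, y] != 0 -> ev s != 0.
Proof. by apply: contraNneq => /ev_eq0 ->. Qed.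

Lemma placeD f g c d : place f c -> place g d -> place (f + g) (c + d).
Proof.
move=> [s [t [t0 -> ->]]] [s' [t' [t0' -> ->]]].
exists (s * t' + s' * t), (t * t').
rewrite !rmorphD !rmorphM /= !hornerE mulf_neq0 //; split=> //.
  by rewrite addf_div ?ev_neq0.
by rewrite addf_div.
Qed.

Lemma placeM f g c d : place f c -> place g d -> place (f * g) (c * d).
Proof.
move=> [s [t [t0 -> ->]]] [s' [t' [t0' -> ->]]].
exists (s * s'), (t * t').
by rewrite !mulf_div !rmorphM /= !hornerM mulf_neq0 //; split.
Qed.

Lemma placeN f c : place f c -> place (- f) (- c).
Proof.
move=> h; have := placeM (placeC (-1)) h.
by rewrite rmorphN rmorph1 !mulN1r.
Qed.

Lemma placeB f g c d : place f c -> place g d -> place (f - g) (c - d).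
Proof. by move=> hf hg; apply: placeD => //; apply: placeN. Qed.

Lemma placeV f c : place f c -> c != 0 -> place f^-1 c^-1.
Proof.
move=> [s [t [t0 -> ->]]]; rewrite mulf_eq0 invr_eq0 (negPf t0) orbF => s0.
by exists t, s; rewrite s0 !invf_div.
Qed.

Lemma placeX f c n : place f c -> place (f ^+ n) (c ^+ n).
Proof.
move=> h; elim: n => [|n IH]; last by rewrite !exprS; apply: placeM.
by rewrite !expr0 -(rmorph1 i); apply: placeC.
Qed.

Lemma place_inj f c d : place f c -> place f d -> c = d.
Proof.
move=> [s [t [t0 -> ->]]] [s' [t' [t0' e ->]]]; apply/eqP.
rewrite eqr_div // -subr_eq0; apply/eqP.
have -> : s.[x, y] * t'.[x, y] - s'.[x, y] * t.[x, y] = (s * t' - s' * t).[x, y].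
  by rewrite !hornerE.
apply: ev_eq0; rewrite rmorphB !rmorphM /= !hornerE; apply/eqP.
by rewrite subr_eq0 -eqr_div ?ev_neq0 // e.
Qed.

End Place.

Section FunctionField.

Variables (K : fieldType) (a b : K).
Local Notation L := (funfield a b).
Local Notation rhs := (weierstrass_rhs a b).
Local Notation X := (funX a b).
Local Notation Y := (funY a b).

Definition polyfun (p : {poly K}) : L := in_alg L (tofrac p).
HB.instance Definition _ :=
  GRing.RMorphism.copy polyfun (in_alg L \o @tofrac {poly K}).

Local Notation wp := (weierstrass_poly a b).

Lemma size_weierstrass_poly : size (mk_monic wp) = 3.
Proof.
rewrite (mk_monicE (weierstrass_poly_irreducible a b)).
by rewrite size_polyDl size_polyXn // size_polyN (leq_ltn_trans (size_polyC_leq1 _)).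
Qed.

Lemma in_qpoly_lin (u v : {fraction {poly K}}) :
  in_qpoly wp (u%:P + v *: 'X) = u%:A + v%:A * Y :> L.
Proof.
rewrite in_qpolyD in_qpolyZ -[u%:P]alg_polyC in_qpolyZ in_qpoly1.
by rewrite /funY -scalerAl mul1r.
Qed.

Lemma funY_sqr : Y ^+ 2 = polyfun rhs.
Proof.
have wp0 : in_qpoly wp wp = 0.
  apply/val_inj => /=; rewrite (mk_monicE (weierstrass_poly_irreducible a b)).
  by rewrite Pdiv.RingMonic.rmodpp //; case: (weierstrass_poly_irreducible a b).
have e : ('X^2 : {poly {fraction {poly K}}}) = wp + (tofrac rhs)%:P.
  by rewrite /weierstrass_poly subrK.
rewrite /funY expr2 -in_qpolyM -expr2 e in_qpolyD wp0 add0r.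
by rewrite -[X in in_qpoly _ X]addr0 -(scale0r 'X) in_qpoly_lin scale0r mul0r addr0.
Qed.

Lemma funY_free p0 p1 : polyfun p0 + polyfun p1 * Y = 0 -> p0 = 0 /\ p1 = 0.
Proof.
rewrite -in_qpoly_lin => e; have {e} := congr1 (@polyn _ _) e.
set q := _ + _; have sq : (size q <= 2)%N.
  rewrite (leq_trans (size_polyD _ _)) // geq_max (leq_trans (size_polyC_leq1 _)) //.
  by rewrite (leq_trans (size_scale_leq _ _)) // size_polyX.
rewrite in_qpoly_small ?size_weierstrass_poly // => q0.
have {}q0 k : q`_k = 0 by rewrite q0 coef0.
have := q0 0%N; have := q0 1%N; rewrite {q0 sq}/q.
rewrite !coefD !coefC !coefZ !coefX mulr1 mulr0 add0r addr0.
by move=> /eqP + /eqP; rewrite !tofrac_eq0 => /eqP -> /eqP ->.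
Qed.

Lemma fraction_num_den (z : {fraction {poly K}}) :
  exists2 d : {poly K}, d != 0 & exists n, z * tofrac d = tofrac n.
Proof.
elim/quotP: z => q _; exists \d_q; first exact: denom_ratioP.
exists \n_q; rewrite !piE; apply/eqP.
rewrite FracField.equivf_def /FracField.mulf.
by rewrite !numden_Ratio ?mulr1 ?oner_neq0 ?denom_ratioP // mulrC.
Qed.

Lemma funfield_num_den (f : L) : exists2 d : {poly K}, d != 0 &
  exists p0 p1, f * polyfun d = polyfun p0 + polyfun p1 * Y.
Proof.
have {f} [u [v ->]] : exists u v, f = u%:A + v%:A * Y.
  have sf : (size (polyn f) < 3)%N.
    by apply: leq_trans (size_mk_monic f) _; rewrite size_weierstrass_poly.
  exists (polyn f)`_0, (polyn f)`_1; rewrite -in_qpoly_lin; apply: val_inj.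
  change (polyn f = polyn (in_qpoly wp (((polyn f)`_0)%:P + (polyn f)`_1 *: 'X))).
  have -> : ((polyn f)`_0)%:P + (polyn f)`_1 *: 'X = polyn f.
    move: (polyn f) sf => q sf.
    apply/polyP => k; rewrite coefD coefC coefZ coefX; case: k => [|[|n]].
    - by rewrite mulr0 addr0.
    - by rewrite mulr1 add0r.
    by rewrite mulr0 addr0 nth_default // (leq_trans _ (isT : (2 <= n.+2)%N)).
  by rewrite in_qpoly_small //; exact: size_mk_monic f.
have [d d0 [n en]] := fraction_num_den u; have [d' d0' [n' en']] := fraction_num_den v.
exists (d * d'); first by rewrite mulf_neq0.
exists (n * d'), (n' * d); rewrite !rmorphM /= mulrDl.
rewrite /polyfun /= -en -en'; congr (_ + _).
  by rewrite -!in_algE !rmorphM mulrA.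
by rewrite -!in_algE !rmorphM /= [X in _ * X = _]mulrC mulrAC [in LHS]mulrA.
Qed.

End FunctionField.

(** * Divisors and the Miller function *)

Lemma deriv_weierstrass_rhs (K : fieldType) (a b x : K) :
  (weierstrass_rhs a b)^`().[x] = 3 * x ^+ 2 + a.
Proof.
rewrite /weierstrass_rhs !derivD derivXn derivZ derivX derivC addr0.
rewrite hornerD hornerMn hornerXn hornerZ hornerC mulr1.
by rewrite -mulr_natl.
Qed.

(** L is the function field of the curve, described by what determines it: phi
    gives the polynomials in x, Y is a square root of the cubic, and every
    element has the form (p0(x) + p1(x) y) / d(x), with p0 and p1 unique for
    given d. *)
Section WeierstrassField.

Variables (K L : fieldType) (a b : K) (phi : {rmorphism {poly K} -> L}) (Y : L).
Local Notation rhs := (weierstrass_rhs a b).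
Hypothesis two_neq0 : 2 != 0 :> K.
Hypothesis Y_sqr : Y ^+ 2 = phi rhs.
Hypothesis Y_free : forall p0 p1, phi p0 + phi p1 * Y = 0 -> p0 = 0 /\ p1 = 0.
Hypothesis Y_den : forall f, exists2 d : {poly K}, d != 0 &
  exists p0 p1, f * phi d = phi p0 + phi p1 * Y.

Let X : L := phi 'X.
Let cst : {rmorphism K -> L} := phi \o polyC.

Lemma cstE c : cst c = phi c%:P. Proof. by []. Qed.

Lemma phi_inj0 p : phi p = 0 -> p = 0.
Proof.
by move=> e; case: (@Y_free p 0) => //; rewrite e rmorph0 mul0r addr0.
Qed.

Lemma phi_neq0 p : p != 0 -> phi p != 0.
Proof. by apply: contraNneq => /phi_inj0 ->. Qed.

Lemma rhs_horner x : rhs.[x] = x ^+ 3 + a * x + b.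
Proof. by rewrite /weierstrass_rhs !hornerE. Qed.

Lemma size_rhs : size rhs = 4%N.
Proof. exact: size_weierstrass_rhs. Qed.

Lemma rhs_neq0 : rhs != 0.
Proof. by rewrite -size_poly_gt0 size_weierstrass_rhs. Qed.

Lemma Y_neq0 : Y != 0.
Proof.
by apply: contraNneq (phi_neq0 rhs_neq0) => Y0; rewrite -Y_sqr Y0 expr0n.
Qed.

Lemma mul_normal p0 p1 q0 q1 :
  (phi p0 + phi p1 * Y) * (phi q0 + phi q1 * Y)
  = phi (p0 * q0 + p1 * q1 * rhs) + phi (p0 * q1 + p1 * q0) * Y.
Proof. by rewrite !rmorphD [phi (_ * rhs)]rmorphM -Y_sqr !rmorphM; ring. Qed.

Lemma add_normal p0 p1 q0 q1 :
  (phi p0 + phi p1 * Y) + (phi q0 + phi q1 * Y)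
  = phi (p0 + q0) + phi (p1 + q1) * Y.
Proof. by rewrite !rmorphD /=; ring. Qed.

Local Notation ev X Y s := (map_poly (map_poly cst) s).[X, Y].

(** Normal forms p0(x) + p1(x) y are evaluated consistently, since the point
    satisfies the equation of the curve. *)
Lemma ev_finite_eq0 x y s : on_curve a b (Some (x, y)) ->
  ev X Y s = 0 -> s.[x, y] = 0.
Proof.
move=> /eqP cxy.
pose R f c := exists p0 p1, f = phi p0 + phi p1 * Y /\ c = p0.[x] + p1.[x] * y.
suff [p0 [p1 [-> ->]]] : R (ev X Y s) s.[x, y].
  by move=> /Y_free [-> ->]; rewrite !horner0 mul0r addr0.
apply: ev_ind.
- by move=> c; exists c%:P, 0; rewrite cstE rmorph0 mul0r addr0 hornerC horner0 mul0r addr0.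
- by exists 'X, 0; rewrite rmorph0 mul0r addr0 hornerX horner0 mul0r addr0.
- by exists 0, 1; rewrite rmorph0 rmorph1 mul1r add0r horner0 hornerC mul1r add0r.
- move=> f g c d [p0 [p1 [-> ->]]] [q0 [q1 [-> ->]]].
  by exists (p0 + q0), (p1 + q1); rewrite add_normal !hornerD; split=> //; ring.
move=> f g c d [p0 [p1 [-> ->]]] [q0 [q1 [-> ->]]].
exists (p0 * q0 + p1 * q1 * rhs), (p0 * q1 + p1 * q0); rewrite mul_normal; split=> //.
by rewrite !(hornerD (_ * _)) (hornerM _ rhs) rhs_horner -cxy !hornerM; ring.
Qed.

(** Functions without finite poles and with a pole of order at most n at
    infinity, where x has order 2 and y has order 3. *)
Let D n f := exists p0 p1 : {poly K},
  [/\ f = phi p0 + phi p1 * Y, (2 * size p0 <= n + 2)%N & (2 * size p1 <= n - 1)%N].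

Let D_add n f g : D n f -> D n g -> D n (f + g).
Proof.
move=> [p0 [p1 [-> l0 l1]]] [q0 [q1 [-> m0 m1]]].
exists (p0 + q0), (p1 + q1); rewrite add_normal; split=> //.
  by have := size_polyD p0 q0; lia.
by have := size_polyD p1 q1; lia.
Qed.

Let D_le m n f : (m <= n)%N -> D m f -> D n f.
Proof. by move=> le [p0 [p1 [-> l0 l1]]]; exists p0, p1; split=> //; lia. Qed.

Let size_mul_le (p q : {poly K}) :
  size (p * q) = 0%N \/ (0 < size p)%N /\ (0 < size q)%N /\ (size (p * q)).+1 = (size p + size q)%N.
Proof.
have [->|p0] := eqVneq p 0; first by rewrite mul0r size_poly0; left.
have [->|q0] := eqVneq q 0; first by rewrite mulr0 size_poly0; left.
right; rewrite !size_poly_gt0 p0 q0 size_mul // prednK //.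
by rewrite addn_gt0 size_poly_gt0 p0.
Qed.

Let D_mul m n f g : D m f -> D n g -> D (m + n) (f * g).
Proof.
move=> [p0 [p1 [-> l0 l1]]] [q0 [q1 [-> m0 m1]]].
exists (p0 * q0 + p1 * q1 * rhs), (p0 * q1 + p1 * q0); rewrite mul_normal.
have s3 := size_rhs.
split=> //.
  have := size_polyD (p0 * q0) (p1 * q1 * rhs).
  have := size_mul_le p0 q0; have := size_mul_le (p1 * q1) rhs.
  have := size_mul_le p1 q1; rewrite s3; move: l0 l1 m0 m1; clear.
  move: (size (p0 * q0)%R) (size (p1 * q1 * rhs)%R) (size (p1 * q1)%R) (size (p0 * q0 + _)%R).
  by move: (size p0) (size p1) (size q0) (size q1) => *; lia.
have := size_polyD (p0 * q1) (p1 * q0).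
have := size_mul_le p0 q1; have := size_mul_le p1 q0; move: l0 l1 m0 m1; clear.
move: (size (p0 * q1)%R) (size (p1 * q0)%R) (size (p0 * q1 + _)%R).
by move: (size p0) (size p1) (size q0) (size q1) => *; lia.
Qed.

Let D_Y k : D (3 * k) (Y ^+ k).
Proof.
elim: k => [|k IH].
  exists 1, 0; rewrite rmorph1 rmorph0 mul0r addr0 expr0.
  by rewrite size_poly0 size_poly1.
rewrite mulnS exprS; apply: D_mul => //; exists 0, 1.
by rewrite rmorph1 rmorph0 mul1r add0r size_poly0 size_poly1.
Qed.

Let D_cst c : D 0 (cst c).
Proof.
exists c%:P, 0; rewrite rmorph0 mul0r addr0 cstE size_poly0; split=> //.
by have := size_polyC_leq1 c; lia.
Qed.

(** If f has value c at infinity, then (f - c) y^k has a pole of order less than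
    3 k for large k.  If f = 0 and c is nonzero, the same would hold for y^k, whose
    even powers are powers of the cubic and have a pole of order exactly 3 k. *)
Lemma ev_infinity_eq0 s : ev (X / Y) Y^-1 s = 0 -> s.[0, 0] = 0.
Proof.
pose R f c := exists k, D (3 * k + 2) ((f - cst c) * Y ^+ k.+1).
suff [k Dk] : R (ev (X / Y) Y^-1 s) s.[0, 0].
  move=> e; rewrite {}e sub0r in Dk; apply/eqP; apply: contraTT isT => c0.
  have {}Dk : D (3 * k + 2) (Y ^+ k.+1).
    have := D_mul (D_cst (- s.[0, 0]^-1)) Dk; rewrite add0n.
    set c := s.[0, 0] in c0 *.
    have -> // : cst (- c^-1) * (- cst c * Y ^+ k.+1) = Y ^+ k.+1.
    by rewrite rmorphN fmorphV; field; rewrite fmorph_eq0.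
  have [p0 [p1 [e l0 _]]] := D_mul Dk Dk.
  have : phi (p0 - rhs ^+ k.+1) + phi p1 * Y = 0.
    rewrite rmorphB rmorphXn /= -Y_sqr exprAC expr2 e; ring.
  case/Y_free => /eqP; rewrite subr_eq0 => /eqP ep0 _.
  have := size_exp rhs k.+1; move: l0; rewrite ep0 size_rhs; move: (size (rhs ^+ _)); clear; lia.
have YK : Y != 0 := Y_neq0.
apply: ev_ind.
- move=> c; exists 0%N; rewrite subrr mul0r -(rmorph0 cst); apply: D_le (D_cst 0); lia.
- exists 0%N; rewrite rmorph0 subr0 expr1 divfK //; exists 'X, 0.
  by rewrite rmorph0 mul0r addr0 size_polyX size_poly0.
- by exists 0%N; rewrite rmorph0 subr0 expr1 mulVf // -(rmorph1 cst); apply: D_le (D_cst 1).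
- move=> f g c d [k Dk] [l Dl]; exists (k + l).+1.
  have := D_add (D_le _ (D_mul Dk (D_Y l.+1))) (D_le _ (D_mul Dl (D_Y k.+1))).
  move=> /(_ (3 * (k + l).+1 + 2)%N).
  rewrite rmorphD -addnS -addSn exprD. 
  set u := Y ^+ _; set v := Y ^+ _.
  have -> : (f + g - (cst c + cst d)) * (u * v) = (f - cst c) * u * v + (g - cst d) * v * u by ring.
  by apply; lia.
move=> f g c d [k Dk] [l Dl]; exists (k + l).+1.
rewrite rmorphM -addnS -addSn exprD. 
have h1 := D_mul (D_cst d) (D_mul Dk (D_Y l.+1)).
have h2 := D_mul (D_cst c) (D_mul Dl (D_Y k.+1)).
have h3 := D_mul Dk Dl.
have -> : (f * g - cst c * cst d) * (Y ^+ k.+1 * Y ^+ l.+1)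
  = (f - cst c) * Y ^+ k.+1 * ((g - cst d) * Y ^+ l.+1)
  + (cst d * ((f - cst c) * Y ^+ k.+1 * Y ^+ l.+1)
     + cst c * ((g - cst d) * Y ^+ l.+1 * Y ^+ k.+1)) by ring.
apply: D_add; first by apply: D_le h3; lia.
by apply: D_add; [apply: D_le h1 | apply: D_le h2]; lia.
Qed.

Definition chart_at (P : point K) : (L * L) * (K * K) :=
  if P is Some xy then ((X, Y), xy) else ((X / Y, Y^-1), (0, 0)).

Definition value_at f (P : point K) c :=
  let: ((U, V), (x, y)) := chart_at P in place cst U V x y f c.

Definition unif_at (P : point K) : L :=
  if P is Some (x, y) then if y == 0 then Y else X - cst x else X / Y.

Definition leading_at f P (n : int) c :=
  exists h, [/\ f = unif_at P ^ n * h, value_at h P c & c != 0].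

Section AtPoint.

Variable P : point K.
Hypothesis P_on : on_curve a b P.

Lemma value_cst c : value_at (cst c) P c.
Proof. by case: P P_on => [[x y]|] h; apply: placeC. Qed.

Lemma value_inj f c d : value_at f P c -> value_at f P d -> c = d.
Proof.
case: P P_on => [[x y]|] h; apply: place_inj.
  by move=> s; apply: ev_finite_eq0 h.
exact: ev_infinity_eq0.
Qed.

Lemma valueD f g c d : value_at f P c -> value_at g P d -> value_at (f + g) P (c + d).
Proof.
case: P P_on => [[x y]|] h; apply: placeD.
  by move=> s; apply: ev_finite_eq0 h.
exact: ev_infinity_eq0.
Qed.

Lemma valueM f g c d : value_at f P c -> value_at g P d -> value_at (f * g) P (c * d).
Proof. by case: P P_on => [[x y]|] h; apply: placeM. Qed.

Lemma valueV f c : value_at f P c -> c != 0 -> value_at f^-1 P c^-1.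
Proof. by case: P P_on => [[x y]|] h; apply: placeV. Qed.

Lemma valueN f c : value_at f P c -> value_at (- f) P (- c).
Proof. by case: P P_on => [[x y]|] h; apply: placeN. Qed.

Lemma valueB f g c d : value_at f P c -> value_at g P d -> value_at (f - g) P (c - d).
Proof. by move=> hf hg; apply: valueD => //; apply: valueN. Qed.

Lemma valueX f c n : value_at f P c -> value_at (f ^+ n) P (c ^+ n).
Proof. by case: P P_on => [[x y]|] h; apply: placeX. Qed.

Lemma value_neq0 f c : value_at f P c -> c != 0 -> f != 0.
Proof.
move=> h; apply: contraNneq => f0; rewrite f0 -(rmorph0 cst) in h.
by apply/eqP/(value_inj h)/value_cst.
Qed.

Lemma unif_neq0 : unif_at P != 0.
Proof.
case: P => [[x y]|] /=.
  case: ifP => _; first exact: Y_neq0.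
  by rewrite -rmorphB phi_neq0 // polyXsubC_eq0.
by rewrite mulf_neq0 ?invr_eq0 ?Y_neq0 // phi_neq0 // polyX_eq0.
Qed.

Lemma unif_value : value_at (unif_at P) P 0.
Proof.
case: P P_on value_cst => [[x y]|] h hc; last exact: place_fst.
rewrite /unif_at; case: eqP => [y0|_]; first by rewrite -[X in value_at _ _ X]y0; apply: place_snd.
rewrite -(subrr x); apply: placeB; [|exact: place_fst|exact: hc].
by move=> s; apply: ev_finite_eq0 h.
Qed.

Lemma leading_unit f c : value_at f P c -> c != 0 -> leading_at f P 0 c.
Proof. by exists f; split=> //; rewrite expr0z mul1r. Qed.

Lemma leading_value f c : leading_at f P 0 c -> value_at f P c.
Proof. by case=> h [-> hv _]; rewrite expr0z mul1r. Qed.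

Lemma leadingM f g m n c d : leading_at f P m c -> leading_at g P n d ->
  leading_at (f * g) P (m + n) (c * d).
Proof.
case=> h [-> hv c0] [k [-> kv d0]]; exists (h * k).
by rewrite mulf_neq0 // expfzDr ?unif_neq0 // mulrACA; split=> //; apply: valueM.
Qed.

Lemma leadingV f m c : leading_at f P m c -> leading_at f^-1 P (- m) c^-1.
Proof.
case=> h [-> hv c0]; exists h^-1.
by rewrite invr_neq0 // invfM -invr_expz; split=> //; apply: valueV.
Qed.

Lemma leading_neq0 f m c : leading_at f P m c -> f != 0.
Proof.
case=> h [-> hv c0]; rewrite mulf_neq0 ?expfz_neq0 ?unif_neq0 //.
exact: value_neq0 hv c0.
Qed.

Lemma leading_inj f m n c d :
  leading_at f P m c -> leading_at f P n d -> m = n /\ c = d.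
Proof.
move=> hm hn; have c0 : c != 0 by case: hm => ? [].
have d0 : d != 0 by case: hn => ? [].
have pos g k e : leading_at g P (Posz k.+1) e -> value_at g P 0.
  case=> h [-> hv _].
  have -> : 0 = 0 ^+ k.+1 * e by rewrite expr0n mul0r.
  by apply: valueM => //; apply: valueX unif_value.
have quo k e : leading_at 1 P k e -> k = 0.
  have v1 : value_at 1 P 1 by rewrite -(rmorph1 cst); apply: value_cst.
  case: k => [[|k]|k] // l; first by have /eqP := value_inj v1 (pos _ _ _ l); rewrite oner_eq0.
  have := leadingV l; rewrite invr1 => l'.
  by have /eqP := value_inj v1 (pos _ _ _ l'); rewrite oner_eq0.
have f0 := leading_neq0 hm.
have := leadingM hm (leadingV hn); rewrite divff // => l.
have /eqP := quo _ _ l; rewrite subr_eq0 => /eqP emn; split=> //.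
rewrite emn subrr in l; have := leading_value l.
have v1 : value_at 1 P 1 by rewrite -(rmorph1 cst); apply: value_cst.
by move/(value_inj v1)/(congr1 (fun z => z * d)); rewrite divfK // mul1r.
Qed.

End AtPoint.

Lemma curve_funE : Y ^+ 2 = X ^+ 3 + cst a * X + cst b.
Proof.
by rewrite Y_sqr /weierstrass_rhs -mul_polyC !rmorphD rmorphXn rmorphM.
Qed.

Let Z := X / Y.

Lemma Z_value : value_at Z None 0.
Proof. exact: place_fst. Qed.

Lemma X_neq0 : X != 0.
Proof. by rewrite phi_neq0 // polyX_eq0. Qed.

Lemma Z_neq0 : Z != 0.
Proof. by rewrite mulf_neq0 ?invr_eq0 ?Y_neq0 ?X_neq0. Qed.

Let inf_on : on_curve a b None := isT.

(** X / Y is a local parameter at infinity, and x^3 / y^2 takes the value 1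
    there. *)
Lemma ZX_value : value_at (Z ^+ 2 * X) None 1.
Proof.
have YK := Y_neq0.
have -> : Z ^+ 2 * X = 1 - cst a * (Z * Y^-1) - cst b * (Y^-1 * Y^-1).
  rewrite /Z; transitivity (X ^+ 3 / Y ^+ 2); first by field.
  by have -> : X ^+ 3 = Y ^+ 2 - cst a * X - cst b; [rewrite curve_funE; ring | field].
have vw : value_at Y^-1 None 0 by exact: place_snd.
have -> : 1 = 1 - a * (0 * 0) - b * (0 * 0) :> K by ring.
apply: valueB => //; last first.
  by apply: valueM => //; [apply: value_cst | apply: valueM].
apply: valueB => //.
  by rewrite -[X in value_at X](rmorph1 cst); apply: value_cst.
by apply: valueM => //; [apply: value_cst | apply: valueM => //; apply: Z_value].
Qed.

Lemma ZY_value : value_at (Z ^+ 3 * Y) None 1.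
Proof.
have -> : Z ^+ 3 * Y = Z ^+ 2 * X by rewrite /Z; field; exact: Y_neq0.
exact: ZX_value.
Qed.

Definition vert c : L := X - cst c.
Definition lin x1 y1 l : L := Y - cst y1 - cst l * vert x1.

Lemma ZV_value c : value_at (Z ^+ 2 * vert c) None 1.
Proof.
rewrite mulrBr -[1]subr0; apply: valueB => //; first exact: ZX_value.
rewrite -(mul0r c); apply: valueM => //; last exact: value_cst.
by rewrite -(mul0r 0) -expr2; apply: valueX => //; apply: Z_value.
Qed.

Lemma vert_infinity c : leading_at (vert c) None (-2) 1.
Proof.
exists (Z ^+ 2 * vert c); split; [|exact: ZV_value|exact: oner_neq0].
by rewrite -[unif_at None]/Z -[-2]/(- 2%:Z) -exprnN mulKf // expf_neq0 // Z_neq0.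
Qed.

Lemma lin_infinity x1 y1 l : leading_at (lin x1 y1 l) None (-3) 1.
Proof.
exists (Z ^+ 3 * lin x1 y1 l); split; [| |exact: oner_neq0].
  by rewrite -[unif_at None]/Z -[-3]/(- 3%:Z) -exprnN mulKf // expf_neq0 // Z_neq0.
have -> : Z ^+ 3 * lin x1 y1 l
   = Z ^+ 3 * Y - cst y1 * Z ^+ 3 - cst l * (Z * (Z ^+ 2 * vert x1)).
  by rewrite /lin; ring.
have -> : 1 = 1 - y1 * 0 ^+ 3 - l * (0 * 1) :> K by ring.
have vc := value_cst inf_on; have vZ := Z_value.
apply: valueB => //; last first.
  by apply: valueM => //; apply: valueM => //; apply: ZV_value.
apply: valueB => //; first exact: ZY_value.
by apply: valueM => //; apply: valueX.
Qed.

Section Finite.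

Variables x y : K.
Hypothesis xy_on : on_curve a b (Some (x, y)).

Lemma X_value : value_at X (Some (x, y)) x.
Proof. exact: place_fst. Qed.

Lemma Y_value : value_at Y (Some (x, y)) y.
Proof. exact: place_snd. Qed.

Lemma vert_value c : value_at (vert c) (Some (x, y)) (x - c).
Proof. by apply: valueB => //; [apply: X_value | apply: value_cst]. Qed.

Lemma lin_value x1 y1 l : value_at (lin x1 y1 l) (Some (x, y)) (y - y1 - l * (x - x1)).
Proof.
have vc := value_cst xy_on.
apply: valueB => //; first by apply: valueB => //; apply: Y_value.
by apply: valueM => //; apply: vert_value.
Qed.

Lemma phi_value p : value_at (phi p) (Some (x, y)) p.[x].
Proof.
elim/poly_ind: p => [|p c IH].
  by rewrite rmorph0 horner0 -(rmorph0 cst); apply: value_cst.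
rewrite rmorphD rmorphM !hornerE; apply: valueD => //; last exact: value_cst.
by apply: valueM => //; apply: X_value.
Qed.

Lemma vert_finite c : y != 0 \/ x != c ->
  exists d, leading_at (vert c) (Some (x, y)) (x == c)%:R d.
Proof.
case: (eqVneq x c) => [<-|nx] h.
  exists 1, 1; split; [|by rewrite -(rmorph1 cst); apply: value_cst | exact: oner_neq0].
  case: h => // /negPf y0; rewrite /unif_at y0 mulr1 expr1z //.
by exists (x - c); apply: leading_unit; [apply: vert_value | rewrite subr_eq0].
Qed.

End Finite.

Lemma some_pair_eq (x y x1 y1 : K) :
  (Some (x, y) == Some (x1, y1)) = (x == x1) && (y == y1).
Proof. by []. Qed.

Lemma vert_divisor x1 y1 P : y1 != 0 -> on_curve a b (Some (x1, y1)) ->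
  on_curve a b P ->
  exists c, leading_at (vert x1) P
    ((P == Some (x1, y1))%:R + (P == Some (x1, - y1))%:R - 2 * (P == None)%:R) c.
Proof.
move=> y10 c1; case: P => [[x y]|] cP; last first.
  by exists 1; exact: vert_infinity.
have yy : y1 != - y1.
  by rewrite -subr_eq0 opprK -mulr2n -mulr_natl mulf_neq0.
rewrite !some_pair_eq mulr0 subr0.
have [ex|nx] := eqVneq x x1; last first.
  have [|d] := @vert_finite _ _ cP x1; first by right.
  by rewrite (negPf nx); exists d.
subst x1; rewrite /=.
have [|d h] := @vert_finite _ _ cP x.
  by left; case: (curve_same_x c1 cP) y10 => ->; rewrite ?oppr_eq0.
exists d; rewrite eqxx in h.
have [e|e] := curve_same_x c1 cP.
  by rewrite -e eqxx (negPf yy) addr0 e.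
by rewrite e opprK eq_sym in yy; rewrite e opprK eqxx (negPf yy) add0r.
Qed.

(** At a zero of the line, its conjugate takes the value 2 y, which is nonzero;
    so the order of the line is that of the product of the three verticals. *)
Lemma lin_divisor x1 y1 l x2 x3 P (y2 := y1 + l * (x2 - x1)) (y3 := y1 + l * (x3 - x1)) :
  (forall x, x ^+ 3 + a * x + b - (y1 + l * (x - x1)) ^+ 2
             = (x - x1) * (x - x2) * (x - x3)) ->
  y1 != 0 -> y2 != 0 -> y3 != 0 -> on_curve a b P ->
  exists c, leading_at (lin x1 y1 l) P
    ((P == Some (x1, y1))%:R + (P == Some (x2, y2))%:R + (P == Some (x3, y3))%:R
     - 3 * (P == None)%:R) c.
Proof.
move=> roots y10 y20 y30; case: P => [[x y]|] cP; last first.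
  by exists 1; exact: lin_infinity.
rewrite !some_pair_eq mulr0 subr0.
have vl := lin_value cP x1 y1 l.
have [e|ne] := eqVneq (y - y1 - l * (x - x1)) 0; last first.
  exists (y - y1 - l * (x - x1)).
  have off x' : (x == x') && (y == y1 + l * (x' - x1)) = false.
    apply/negP => /andP[/eqP ex /eqP ey]; case/eqP: ne.
    by rewrite ex ey; ring.
  have := off x1; rewrite subrr mulr0 addr0 => ->.
  by rewrite !off; apply: leading_unit.
have ey : y = y1 + l * (x - x1).
  by apply/eqP; rewrite -subr_eq0 opprD addrA e.
have on' x' y' : y' = y1 + l * (x' - x1) -> (x == x') && (y == y') = (x == x').
  by move=> ->; case: eqVneq => //= <-; rewrite ey eqxx.
rewrite !on' ?subrr ?mulr0 ?addr0 //.
have [d1 l1] : exists d, leading_at (vert x1) (Some (x, y)) (x == x1)%:R d.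
  apply: vert_finite => //; case: (eqVneq x x1) => [ex|]; [left|by right].
  by rewrite ey ex subrr mulr0 addr0.
have [d2 l2] : exists d, leading_at (vert x2) (Some (x, y)) (x == x2)%:R d.
  by apply: vert_finite => //; case: (eqVneq x x2) => [ex|]; [left; rewrite ey ex|right].
have [d3 l3] : exists d, leading_at (vert x3) (Some (x, y)) (x == x3)%:R d.
  by apply: vert_finite => //; case: (eqVneq x x3) => [ex|]; [left; rewrite ey ex|right].
have y0 : y != 0.
  have := roots x; rewrite -ey -(eqP cP) subrr => /esym/eqP.
  rewrite !mulf_eq0 !subr_eq0 -orbA ey => /or3P[] /eqP -> //.
  by rewrite subrr mulr0 addr0.
pose m := Y + cst y1 + cst l * vert x1.
have vm : value_at m (Some (x, y)) (y + y1 + l * (x - x1)).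
  have vc := value_cst cP.
  apply: valueD => //; first by apply: valueD => //; apply: Y_value.
  by apply: valueM => //; apply: vert_value.
have m0 : y + y1 + l * (x - x1) != 0.
  by rewrite -addrA -ey -mulr2n -mulr_natl mulf_neq0.
have lm := leading_unit vm m0.
have norm : lin x1 y1 l = vert x1 * vert x2 * vert x3 * m^-1.
  apply: (canRL (mulfK _)); first exact: value_neq0 vm m0.
  pose c2 := x1 + x2 + x3 - l ^+ 2.
  pose c1 := a - 2 * l * (y1 - l * x1) - (x1 * x2 + x1 * x3 + x2 * x3).
  pose c0 := b - (y1 - l * x1) ^+ 2 + x1 * x2 * x3.
  have id z : c2 * z ^+ 2 + c1 * z + c0 = 0.
    transitivity (z ^+ 3 + a * z + b - (y1 + l * (z - x1)) ^+ 2
                  - (z - x1) * (z - x2) * (z - x3)).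
      by rewrite /c2 /c1 /c0; ring.
    by rewrite roots subrr.
  have c00 : c0 = 0 by rewrite -[RHS](id 0); ring.
  have c10 : c1 = 0.
    apply: (mulfI two_neq0); rewrite mulr0 -[RHS]subr0 -{1}(id 1) -(id (-1)); ring.
  have c20 : c2 = 0 by rewrite -[RHS](id 1) c10 c00; ring.
  transitivity (Y ^+ 2 - (cst y1 + cst l * vert x1) ^+ 2); first by rewrite /lin /m; ring.
  transitivity (vert x1 * vert x2 * vert x3
                + (cst c2 * X ^+ 2 + cst c1 * X + cst c0)); last first.
    by rewrite c00 c10 c20 rmorph0 !mul0r !addr0.
  rewrite curve_funE /vert /c0 /c1 /c2.
  by rewrite !(rmorphD, rmorphN, rmorphM, rmorphXn, rmorph1); ring.
exists (d1 * d2 * d3 * (y + y1 + l * (x - x1))^-1).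
rewrite norm -[X in leading_at _ _ X]addr0 -oppr0.
by apply: leadingM => //; [apply: leadingM => //; apply: leadingM | apply: leadingV].
Qed.

Lemma phi_infinity (p : {poly K}) n : (size p <= n.+1)%N ->
  value_at (phi p * Z ^+ (2 * n)) None p`_n.
Proof.
have vc := value_cst inf_on; have vZ := Z_value.
elim/poly_ind: p n => [|p c IH] n sp.
  by rewrite rmorph0 mul0r coef0 -(rmorph0 cst).
have -> k : (p * 'X + c%:P)`_k = if k == 0%N then c else p`_k.-1.
  by rewrite -cons_poly_def coef_cons.
case: n sp => [|n] sp.
  have p0 : p = 0.
    apply/eqP; apply: contraLR sp => p0; rewrite -ltnNge.
    by rewrite size_MXaddC (negPf p0) /= ltnS size_poly_gt0.
  by rewrite p0 mul0r add0r muln0 expr0 mulr1; exact: vc.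
have {}sp : (size p <= n.+1)%N.
  by move: sp; rewrite size_MXaddC; case: ifP => // /andP[/eqP-> _]; rewrite size_poly0.
have -> : phi (p * 'X + c%:P) * Z ^+ (2 * n.+1)
   = phi p * Z ^+ (2 * n) * (Z ^+ 2 * X) + cst c * (Z ^+ (2 * n) * (Z * Z)).
  by rewrite rmorphD rmorphM mulnS addnC exprD -[phi c%:P]/(cst c) -/X; ring.
have -> : p`_n = p`_n * 1 + c * (0 ^+ (2 * n) * (0 * 0)) by ring.
apply: valueD => //.
  by apply: valueM => //; [apply: IH | apply: ZX_value].
by apply: valueM => //; apply: valueM => //; [apply: valueX | apply: valueM].
Qed.

(** The terms p0(x) and p1(x) y have poles of even and of odd order at infinity,
    which cannot cancel. *)
Lemma regular_infinity p0 p1 c : value_at (phi p0 + phi p1 * Y) None c ->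
  p1 = 0 /\ (size p0 <= 1)%N.
Proof.
move=> vf; have vc := value_cst inf_on; have vZ := Z_value.
have kill n : value_at ((phi p0 + phi p1 * Y) * Z ^+ n.+1) None 0.
  have -> : 0 = c * 0 ^+ n.+1 by rewrite expr0n mulr0.
  by apply: valueM => //; apply: valueX.
have v0 : value_at 0 None 0 by rewrite -(rmorph0 cst).
have lead (p : {poly K}) n : size p = n.+1 -> p`_n <> 0.
  by move=> sp /eqP; rewrite -[n]/(n.+1.-1) -sp lead_coef_eq0 -size_poly_eq0 sp.
have [/andP[p10 le]|nA] := boolP ((p1 != 0) && (size p0 <= (size p1).+1)%N).
  case e1: (size p1) le => [|m] le; first by rewrite -size_poly_eq0 e1 in p10.
  case: (lead _ _ e1); apply: (value_inj inf_on _ (kill (2 * m + 2)%N)).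
  have -> : (phi p0 + phi p1 * Y) * Z ^+ (2 * m + 2).+1
      = phi p0 * Z ^+ (2 * m.+1) * Z + phi p1 * Z ^+ (2 * m) * (Z ^+ 3 * Y).
    by rewrite -addn1 mulnS !exprD; ring.
  have -> : p1`_m = p0`_m.+1 * 0 + p1`_m * 1 by ring.
  apply: valueD => //.
    by apply: valueM => //; apply: phi_infinity.
  by apply: valueM => //; [apply: phi_infinity; rewrite e1 | apply: ZY_value].
have [le1|gt1] := leqP (size p0) 1.
  split=> //; apply/eqP; apply: contraR nA => p10; rewrite p10.
  by rewrite (leq_trans le1).
case e0: (size p0) gt1 => [|[|k]] // _.
case: (lead _ _ e0); apply: (value_inj inf_on _ (kill (2 * k + 1)%N)).
have -> : (phi p0 + phi p1 * Y) * Z ^+ (2 * k + 1).+1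
    = phi p0 * Z ^+ (2 * k.+1) + phi p1 * Y * Z ^+ (2 * k + 2).
  by rewrite -addn1 -addnA mulnS [(2 + _)%N]addnC; ring.
rewrite -[p0`_k.+1]addr0; apply: valueD => //; first by apply: phi_infinity; rewrite e0.
have [->|p10] := eqVneq p1 0; first by rewrite rmorph0 !mul0r.
move: nA; rewrite p10 e0 -ltnNge ltnS => s1.
case: k s1 {e0} => [|j] s1; first by rewrite ltnS leqn0 size_poly_eq0 (negPf p10) in s1.
have -> : phi p1 * Y * Z ^+ (2 * j.+1 + 2) = phi p1 * Z ^+ (2 * j) * (Z ^+ 3 * Y) * Z.
  by rewrite mulnS [(2 + _)%N]addnC -addnA exprD; ring.
have -> : 0 = p1`_j * 1 * 0 :> K by ring.
apply: valueM => //; apply: valueM => //; last exact: ZY_value.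
exact: phi_infinity.
Qed.

Hypothesis K_closed : forall p : {poly K}, size p != 1%N -> exists x, root p x.
Hypothesis nonsingular : forall x, rhs.[x] = 0 -> 3 * x ^+ 2 + a != 0.

Lemma curve_point x : exists y, on_curve a b (Some (x, y)).
Proof.
have [|y] := K_closed (p := 'X^2 - (rhs.[x])%:P).
  by rewrite size_XnsubC.
rewrite rootE hornerD hornerN hornerXn hornerC subr_eq0 rhs_horner => /eqP e.
by exists y; apply/eqP.
Qed.

(** A function regular at all finite points is a polynomial in x and y: in a
    fraction with denominator of least degree, a root of the denominator is
    the abscissa of points where the numerator vanishes, hence can be
    cancelled.  At a point of ordinate 0 the vanishing of p1 comes from a second
    evaluation, after multiplication by y. *)
Lemma regular_finite f :
  (forall x y, on_curve a b (Some (x, y)) -> exists c, value_at f (Some (x, y)) c) ->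
  exists p0 p1, f = phi p0 + phi p1 * Y.
Proof.
move=> reg; have [d d0 [p0 [p1 e]]] := Y_den f.
have [n] := ubnP (size d); elim: n d p0 p1 d0 e => // n IH d p0 p1 d0 e sd.
have [/size_poly1P[c c0 ed]|/K_closed[x]] := boolP (size d == 1%N).
  exists (c^-1 *: p0), (c^-1 *: p1).
  apply: (mulIf (phi_neq0 d0)); rewrite e -!mul_polyC !rmorphM ed.
  have inv : phi (c^-1)%:P * phi c%:P = 1 by rewrite -rmorphM -polyCM mulVf // rmorph1.
  rewrite -[LHS]mul1r -inv; ring.
move=> /factor_theorem[d' ed].
have d'0 : d' != 0 by apply: contraNneq d0 => z; rewrite ed z mul0r.
have sd' : (size d' < n)%N.
  by move: sd; rewrite ed size_Mmonic ?monicXsubC // size_XsubC addn2.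
have V0 : phi ('X - x%:P) != 0 by rewrite phi_neq0 // polyXsubC_eq0.
have [y cy] := curve_point x.
have cy' : on_curve a b (Some (x, - y)) by rewrite /= sqrrN.
have vanish y' : on_curve a b (Some (x, y')) -> p0.[x] + p1.[x] * y' = 0.
  move=> c'; have [v hv] := reg _ _ c'.
  have h1 : value_at (f * phi d) (Some (x, y')) (v * d.[x]).
    by apply: valueM => //; apply: phi_value.
  have -> : 0 = v * d.[x] by rewrite ed hornerM hornerXsubC subrr !mulr0.
  apply: (value_inj c' _ h1); rewrite e; apply: valueD => //; first exact: phi_value.
  by apply: valueM => //; [apply: phi_value | apply: Y_value].
have h1 := vanish _ cy; have h2 := vanish _ cy'.
have p0x : p0.[x] = 0.
  by apply: (mulfI two_neq0); rewrite mulr0 -[RHS]addr0 -{1}h1 -h2; ring.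
have /factor_theorem[q0 eq0] : root p0 x by rewrite rootE p0x.
suff /eqP/factor_theorem[q1 eq1] : p1.[x] = 0.
  apply: (IH d' q0 q1) => //; apply: (mulIf V0).
  move: e; rewrite ed eq0 eq1 !rmorphM mulrA => ->; ring.
have [y0|y0] := eqVneq y 0; last first.
  by apply: (mulIf y0); rewrite mul0r -[RHS]h1 p0x add0r.
have /factor_theorem[g eg] : root rhs x.
  by rewrite rootE rhs_horner -(eqP cy) y0 expr0n.
have gx : g.[x] != 0.
  have := nonsingular (x := x); rewrite {1}eg hornerM hornerXsubC subrr mulr0.
  move/(_ erefl); apply: contraNneq => gx0.
  apply/eqP; rewrite -(deriv_weierstrass_rhs a b) eg derivM derivXsubC mulr1.
  by rewrite hornerD hornerM hornerXsubC subrr mulr0 add0r gx0.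
have [v hv] := reg _ _ cy.
pose h := f * phi d' - phi q0.
have hh : value_at h (Some (x, y)) (v * d'.[x] - q0.[x]).
  by apply: valueB => //; [apply: valueM => // |]; apply: phi_value.
have eh : h * Y = phi (p1 * g).
  apply: (mulIf V0); transitivity ((f * phi d - phi p0) * Y).
    by rewrite /h ed eq0 !rmorphM; ring.
  by rewrite e addrAC subrr add0r -mulrA -expr2 Y_sqr eg !rmorphM mulrA.
have : (p1 * g).[x] = 0.
  apply: (value_inj cy (phi_value cy _)); rewrite -eh.
  have -> : 0 = (v * d'.[x] - q0.[x]) * y by rewrite y0 mulr0.
  by apply: valueM => //; apply: Y_value.
by rewrite hornerM => /eqP; rewrite mulf_eq0 (negPf gx) orbF => /eqP.
Qed.

Lemma regular_const f :
  (forall P, on_curve a b P -> exists c, value_at f P c) -> exists c, f = cst c.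
Proof.
move=> reg; have [x y cxy|p0 [p1 ef]] := @regular_finite f; first exact: reg.
have [c] := reg None inf_on; rewrite ef => /regular_infinity[-> /size1_polyC ->].
by exists p0`_0; rewrite rmorph0 mul0r addr0.
Qed.

(** A quotient of two functions with equal divisors is constant, and the
    normalization at infinity determines the constant. *)
Lemma same_divisor f g :
  (forall P, on_curve a b P ->
     exists n c d, leading_at f P n c /\ leading_at g P n d) ->
  (exists n, leading_at f None n 1) -> (exists n, leading_at g None n 1) ->
  f = g.
Proof.
move=> same [m fm] [m' gm'].
have [n [c [d [lf lg]]]] := same None inf_on.
have g0 : g != 0 by exact: leading_neq0 lg.
have [em _] := leading_inj inf_on fm lf; have [em' _] := leading_inj inf_on gm' lg.
have l1 := leadingM inf_on fm (leadingV inf_on gm').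
rewrite em em' subrr divr1 in l1; have v1 := leading_value l1.
have [P cP|k ek] := @regular_const (f / g).
  have [n' [c' [d' [lf' lg']]]] := same P cP.
  have := leadingM cP lf' (leadingV cP lg'); rewrite subrr => /leading_value h.
  by eexists; exact: h.
rewrite ek in v1; have ek1 := value_inj inf_on v1 (value_cst inf_on k).
by move: ek; rewrite -ek1 rmorph1 => /divr1_eq.
Qed.

Section Miller.

Variables x1 y1 : K.
Let Q : point K := Some (x1, y1).
Hypothesis Q_on : on_curve a b Q.
Variable r : nat.
Hypotheses (r_prime : prime r) (r_odd : odd r) (smul_r : smul a x1 y1 r = None).
Local Notation smul := (smul a x1 y1).

Definition miller_at (n : int) f :=
  (forall P, on_curve a b P -> exists c, leading_at f P
     (n * (P == Q)%:R - (P == mulp a n Q)%:R - (n - 1) * (P == None)%:R) c)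
  /\ exists m, leading_at f None m 1.

Definition abscissa (P : point K) : K := if P is Some (x, _) then x else 0.

Definition chord_at (S : point K) : L :=
  if S is Some (x, y) then lin x1 y1 (slope a (x1, y1) (x, y)) else 1.

(** The index is shifted: this is the Miller function f_{n+1,Q}. *)
Fixpoint miller_fun n : L :=
  if n is n'.+1 then
    miller_fun n' * (chord_at (smul n) / vert (abscissa (smul n.+1)))
  else 1.

Lemma miller_funS n : miller_fun n.+1
  = miller_fun n * (chord_at (smul n.+1) / vert (abscissa (smul n.+2))).
Proof. by []. Qed.

Lemma smul_lt_neq0 n : (0 < n < r)%N -> exists x y,
  [/\ smul n = Some (x, y), on_curve a b (Some (x, y)) & y != 0].
Proof.
case/andP=> n0 nr.
have [|[x y] e] := smul_finite two_neq0 Q_on r_prime r_odd smul_r (n := n).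
  by apply/negP => /(dvdn_leq n0); rewrite leqNgt nr.
exists x, y; split=> //; first by rewrite -e; apply: smul_on.
exact: (smul_y_neq0 two_neq0 Q_on r_prime r_odd smul_r e).
Qed.

(** In the step of the Miller recursion the vertical cancels the third
    intersection of the chord. *)
Lemma chord_divisor xS yS xT yT P :
  on_curve a b (Some (xS, yS)) -> yS != 0 -> yT != 0 ->
  addp a Q (Some (xS, yS)) = Some (xT, yT) -> on_curve a b P ->
  exists c, leading_at (chord_at (Some (xS, yS)) / vert xT) P
    ((P == Q)%:R + (P == Some (xS, yS))%:R - (P == Some (xT, yT))%:R
     - (P == None)%:R) c.
Proof.
move=> cS yS0 yT0 eT cP.
have cT : on_curve a b (Some (xT, yT)) by rewrite -eT on_curve_addp.
have nop : ~~ opposite x1 y1 xS yS.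
  by apply/negP => op; move: eT; rewrite /Q /addp -/(opposite _ _ _ _) op.
have y10 := base_y_neq0 r_odd smul_r.
have [eS _] := slopeP two_neq0 Q_on cS nop.
have roots z := chord_roots two_neq0 z Q_on cS nop.
move: eT; rewrite addp_finite //.
rewrite /chord_at; move: (slope a _ _) eS roots => l eS roots [eT1 eT2].
rewrite eT1 in eT2; rewrite eT1 in roots.
have eNT : - yT = y1 + l * (xT - x1) by rewrite -eT2; ring.
have [||c hc] := lin_divisor roots y10 _ _ cP.
- by rewrite -eS.
- by rewrite -eNT oppr_eq0.
have [d hd] := vert_divisor yT0 cT cP.
have := leadingM cP hc (leadingV cP hd); rewrite -eS -eNT => h.
exists (c * d^-1); move: h; set n1 := _ - _; set n2 := _ - _ => h.
by have <- : n1 = n2; [rewrite /n1 /n2 -/Q; ring | exact: h].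
Qed.

Lemma chord_normalized S xT : S != None ->
  exists m, leading_at (chord_at S / vert xT) None m 1.
Proof.
case: S => [[xS yS]|] // _; eexists; rewrite -[1]divr1.
by apply: leadingM => //; [apply: lin_infinity | apply: leadingV => //; apply: vert_infinity].
Qed.

Lemma miller_fun_spec n : (n.+1 < r)%N -> miller_at n.+1 (miller_fun n).
Proof.
have v1 P : on_curve a b P -> leading_at 1 P 0 1.
  by move=> cP; apply: leading_unit; [rewrite -(rmorph1 cst); apply: value_cst | exact: oner_neq0].
elim: n => [|n IH] nr.
  split=> [P cP|]; last by exists 0; apply: v1.
  by exists 1; rewrite mul1r -[mulp a 1 Q]/Q !subrr mul0r subr0; apply: v1.
have [div [m norm]] := IH (ltnW nr).
have [|xS [yS [eS cS yS0]]] := @smul_lt_neq0 n.+1; first exact: ltnW nr.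
have [|xT [yT [eT cT yT0]]] := @smul_lt_neq0 n.+2; first by [].
have eQT := eT; rewrite smulS eS in eQT.
rewrite miller_funS eT eS /abscissa.
split=> [P cP|]; last first.
  have [m' h] := @chord_normalized (Some (xS, yS)) xT isT.
  by exists (m + m'); rewrite -[1]mulr1; apply: leadingM.
have [c hc] := div P cP; have [d hd] := chord_divisor cS yS0 yT0 eQT cP.
exists (c * d); have := leadingM cP hc hd.
rewrite -[mulp a n.+1 Q]/(smul n.+1) -[mulp a n.+2 Q]/(smul n.+2) eS eT.
set n1 := _ + _; set n2 := _ - _ => h.
by have <- : n1 = n2; [rewrite /n1 /n2 -/Q !intS; ring | exact: h].
Qed.

Lemma miller_fun_spec_neg n : (n.+1 < r)%N ->
  miller_at (- Posz n.+1) (miller_fun n * vert (abscissa (smul n.+1)))^-1.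
Proof.
move=> nr; have [div [m norm]] := miller_fun_spec nr.
have [|x [y [e c y0]]] := @smul_lt_neq0 n.+1; first by [].
rewrite e /abscissa; split=> [P cP|]; last first.
  exists (- (m - 2)); rewrite -[X in leading_at _ _ _ X]invr1; apply: leadingV => //.
  by rewrite -[X in leading_at _ _ _ X]mulr1; apply: leadingM => //; apply: vert_infinity.
have [k hk] := div P cP; have [d hd] := vert_divisor y0 c cP.
exists (k * d)^-1; have := leadingV cP (leadingM cP hk hd).
rewrite -[mulp a (- _) Q]/(oppp (smul n.+1)) -[mulp a n.+1 Q]/(smul n.+1) e.
set n1 := - _; set n2 := _ - _ => h.
by have <- : n1 = n2; [rewrite /n1 /n2 /oppp; ring | exact: h].
Qed.

Section Evaluation.

Variables x2 y2 : K.
Let P : point K := Some (x2, y2).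
Hypothesis P_on : on_curve a b P.
Hypothesis P_indep : independent a x1 y1 P.

(** The value of f_{n+1,Q} at P. *)
Fixpoint miller_eval n : K :=
  if n is n'.+1 then
    miller_eval n' * (line a (smul n) Q P / (x2 - abscissa (smul n.+1)))
  else 1.

Lemma miller_evalS n : miller_eval n.+1
  = miller_eval n * (line a (smul n.+1) Q P / (x2 - abscissa (smul n.+2))).
Proof. by []. Qed.

Lemma miller_fun_value n : (n.+1 < r)%N ->
  value_at (miller_fun n) P (miller_eval n).
Proof.
elim: n => [|n IH] nr; first by rewrite /= -(rmorph1 cst); apply: value_cst.
have [|xS [yS [eS cS yS0]]] := @smul_lt_neq0 n.+1; first exact: ltnW nr.
have [|xT [yT [eT cT yT0]]] := @smul_lt_neq0 n.+2; first by [].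
have eQT := eT; rewrite smulS eS in eQT.
rewrite miller_funS miller_evalS eT eS /abscissa.
apply: valueM => //; first by apply: IH; apply: ltnW.
apply: valueM => //; last first.
  apply: valueV => //; first exact: vert_value.
  by rewrite subr_eq0 (independent_abscissa two_neq0 Q_on r_prime r_odd smul_r P_on P_indep eT).
have nop : ~~ opposite x1 y1 xS yS.
  by apply/negP => op; move: eQT; rewrite /Q /addp -/(opposite _ _ _ _) op.
have [e _] := slopeP two_neq0 Q_on cS nop.
have -> : line a (Some (xS, yS)) Q P = y2 - y1 - slope a (x1, y1) (xS, yS) * (x2 - x1).
  by rewrite /line /Q /P slope_sym; move: (slope a _ _) e => l ->; ring.
exact: lin_value.
Qed.

Lemma miller_fun_value_neg n x y : (n.+1 < r)%N -> smul n.+1 = Some (x, y) ->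
  miller_eval n != 0 ->
  value_at (miller_fun n * vert (abscissa (smul n.+1)))^-1 P
    (miller_eval n * (x2 - x))^-1.
Proof.
move=> nr e f0.
have nx : x2 - x != 0.
  by rewrite subr_eq0 (independent_abscissa two_neq0 Q_on r_prime r_odd smul_r P_on P_indep e).
rewrite e; apply: valueV => //; last by rewrite mulf_neq0.
by apply: valueM => //; [apply: miller_fun_value | apply: vert_value].
Qed.

End Evaluation.

End Miller.

End WeierstrassField.

(** * The value of the Miller function *)

Section MillerValue.

Variables (K : closedFieldType) (a b : K).
Hypothesis two_neq0 : 2 != 0 :> K.
Hypothesis nonsingular : forall x, (weierstrass_rhs a b).[x] = 0 -> 3 * x ^+ 2 + a != 0.

Let L : fieldType := funfield a b.
Let Y : L := funY a b.
Let phi : {rmorphism {poly K} -> L} := polyfun a b.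

Let Y_sqr : Y ^+ 2 = phi (weierstrass_rhs a b).
Proof. exact: funY_sqr. Qed.

Let Y_free p0 p1 : phi p0 + phi p1 * Y = 0 -> p0 = 0 /\ p1 = 0.
Proof. exact: funY_free. Qed.

Let Y_den (f : L) : exists2 d : {poly K}, d != 0 &
  exists p0 p1, f * phi d = phi p0 + phi p1 * Y.
Proof. exact: funfield_num_den. Qed.

Let has_value_at (f : L) P c : @has_value K a b f P c <-> value_at phi Y f P c.
Proof. case: P => [[x y]|]; reflexivity. Qed.

Let uniformizer_at P : @uniformizer K a b P = unif_at phi Y P.
Proof. reflexivity. Qed.

Let leading_to (f : L) P n c : @leading K a b f P n c -> leading_at phi Y f P n c.
Proof.
case=> h [ef hv c0]; exists h; split; [|exact (proj1 (has_value_at h P c) hv)|exact c0].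
by rewrite -uniformizer_at; exact: ef.
Qed.

Let leading_from (f : L) P n c : leading_at phi Y f P n c -> @leading K a b f P n c.
Proof.
case=> h [ef hv c0]; exists h; split; [|exact (proj2 (has_value_at h P c) hv)|exact c0].
by rewrite uniformizer_at; exact: ef.
Qed.

Let is_miller_to n x1 y1 (f : L) :
  @is_miller K a b n (Some (x1, y1)) f -> miller_at a b phi Y x1 y1 n f.
Proof.
case=> div [m norm]; split; last by exists m; exact (leading_to norm).
by move=> P cP; have [c h] := div P cP; exists c; exact (leading_to h).
Qed.

Let is_miller_from n x1 y1 (f : L) :
  miller_at a b phi Y x1 y1 n f -> @is_miller K a b n (Some (x1, y1)) f.
Proof.
case=> div [m norm]; split; last by exists m; exact (leading_from norm).
by move=> P cP; have [c h] := div P cP; exists c; exact (leading_from h).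
Qed.

Let closed_roots (p : {poly K}) : size p != 1%N -> exists x, root p x.
Proof. exact/closed_rootP. Qed.

Lemma funeval_miller n x1 y1 F P v :
  on_curve a b P -> miller_at a b phi Y x1 y1 n F -> value_at phi Y F P v ->
  funeval (miller a b n (Some (x1, y1))) P = v.
Proof.
move=> cP mF vF.
have := classical_sets.xgetPex 0 (ex_intro _ F (is_miller_from mF)).
rewrite -/(miller a b n (Some (x1, y1))); move: (miller _ _ _ _) => G /is_miller_to mG.
have eG : (G : L) = F.
  apply: (same_divisor two_neq0 Y_sqr Y_free Y_den closed_roots nonsingular);
    [|exact: mG.2|exact: mF.2].
  move=> R cR; have [c hc] := mG.1 R cR; have [d hd] := mF.1 R cR.
  by exists (n * (R == Some (x1, y1))%:R - (R == mulp a n (Some (x1, y1)))%:R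
                          - (n - 1) * (R == None)%:R), c, d.
rewrite eG; have := classical_sets.xgetPex 0 (ex_intro _ v (proj2 (has_value_at F P v) vF)).
rewrite -/(funeval F P) => vF'; have vG := proj1 (has_value_at F P _) vF'.
exact (value_inj two_neq0 Y_sqr Y_free cP vG vF).
Qed.

Variables (x1 y1 : K).
Let Q : point K := Some (x1, y1).
Hypothesis Q_on : on_curve a b Q.
Variable r : nat.
Hypotheses (r_prime : prime r) (r_odd : odd r) (smul_r : smul a x1 y1 r = None).
Local Notation smul := (smul a x1 y1).
Variables x2 y2 : K.
Let P : point K := Some (x2, y2).
Hypothesis P_on : on_curve a b P.
Hypothesis P_indep : independent a x1 y1 P.

Lemma miller_value n : (n.+1 < r)%N ->
  funeval (miller a b n.+1 Q) P = miller_eval a x1 y1 x2 y2 n.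
Proof.
move=> nr; apply: funeval_miller P_on _ _.
  exact: (miller_fun_spec two_neq0 Y_sqr Y_free Q_on r_prime r_odd smul_r nr).
exact: (miller_fun_value two_neq0 Y_sqr Y_free Q_on r_prime r_odd smul_r P_on P_indep nr).
Qed.

Lemma miller_value_neg n x y : (n.+1 < r)%N -> smul n.+1 = Some (x, y) ->
  miller_eval a x1 y1 x2 y2 n != 0 ->
  funeval (miller a b (- Posz n.+1) Q) P = (miller_eval a x1 y1 x2 y2 n * (x2 - x))^-1.
Proof.
move=> nr e f0; apply: funeval_miller P_on _ _.
  exact: (miller_fun_spec_neg two_neq0 Y_sqr Y_free Q_on r_prime r_odd smul_r nr).
exact: (miller_fun_value_neg two_neq0 Y_sqr Y_free Q_on r_prime r_odd smul_r P_on P_indep nr e f0).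
Qed.

End MillerValue.

(** * The parameters of the curve *)

Section Arithmetic.

Import Num.Theory.

Variables (u : int) (p r : nat).
Hypotheses (p_prime : prime p) (r_prime : prime r).
Hypothesis r_def : r%:R = kss16_r u%:~R.
Hypothesis embed : embedding_degree p r 16.
Local Notation m := `|u|%N.

Lemma kss_r_def : (1225 * 50 * r = m ^ 4 * m ^ 4 + 48 * m ^ 4 + 625)%N.
Proof.
have e : (u%:~R ^+ 2 : rat) = m%:R ^+ 2.
  have -> : (m%:R : rat) = `|u%:~R| by rewrite -intr_norm -abszE.
  by rewrite real_normK ?num_real.
have e4 : (u%:~R ^+ 4 : rat) = (m ^ 4)%:R.
  by rewrite natrX (exprM _ 2 2) e -exprM.
apply/eqP; rewrite -(eqr_nat rat); apply/eqP.
rewrite natrM r_def /kss16_r (exprM _ 4 2) e4 2!natrD 3!natrM.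
by move: ((m ^ 4)%:R : rat) => y; field.
Qed.

Let r_dvd : (r %| p ^ 16 - 1)%N. Proof. by case: embed. Qed.

(** By Fermat's little theorem, the embedding degree 16 divides r - 1. *)
Lemma kss_r_ge17 : (17 <= r)%N.
Proof.
have [_ _ min] := embed; rewrite leqNgt; apply/negP => r_lt.
have r1 := prime_gt1 r_prime; have p0 := prime_gt0 p_prime.
have cop : coprime r p.
  rewrite prime_coprime //; apply/negP => rp.
  have := dvdn_sub (dvdn_exp (isT : (0 < 16)%N) rp) r_dvd.
  rewrite subKn ?expn_gt0 ?p0 // dvdn1 => /eqP re; by rewrite re in r1.
have : (r %| p ^ r.-1 - 1)%N.
  rewrite -(Gauss_dvdr _ cop) mulnBr muln1 -expnS prednK ?prime_gt0 //.
  rewrite -eqn_mod_dvd; first by apply/eqP/fermat_little.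
  by rewrite -{1}(expn1 p) leq_pexp2l // ltnW.
by apply/negP/min; lia.
Qed.

Lemma kss_r_odd : odd r.
Proof.
by case: (even_prime r_prime) => // r2; have := kss_r_ge17; rewrite r2.
Qed.

Lemma kss_r_dvd : (r %| p ^ 8 + 1)%N.
Proof.
have [_ _ min] := embed; have p0 := prime_gt0 p_prime.
have := r_dvd; have -> : (p ^ 16 - 1 = (p ^ 8 - 1) * (p ^ 8 + 1))%N.
  by rewrite (expnM p 8 2) -[X in (_ - X)%N]/(1 ^ 2)%N subn_sqr.
by rewrite Euclid_dvdM // (negPf (min 8%N isT)).
Qed.

Lemma kss_u_ge6 : (6 <= m)%N.
Proof.
rewrite leqNgt; apply/negP => lt; have r17 := kss_r_ge17.
have := kss_r_def; have : (m ^ 4 <= 5 ^ 4)%N by rewrite leq_exp2r.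
have -> : (5 ^ 4 = 25 * 25)%N by [].
by move: (m ^ 4)%N r17; clear; nia.
Qed.

Lemma kss_u4_ge : (216 * m <= m ^ 4)%N /\ (1296 <= m ^ 4)%N.
Proof.
have m6 := kss_u_ge6; have m2 : (36 <= m * m)%N by exact: (leq_mul m6 m6).
have -> : (m ^ 4 = m * m * (m * m))%N by rewrite (expnM m 2 2) !mulnn.
split; last exact: (leq_mul m2 m2).
by rewrite [(216 * m)%N]mulnC -mulnA leq_mul2l (leq_mul m6 m2) orbT.
Qed.

(** u^8 is less than 61250 r, hence u is much smaller than r. *)
Lemma kss_u_lt : (m + 5 < r)%N.
Proof.
rewrite ltnNge; apply/negP => le; have m6 := kss_u_ge6.
have [y1 y2] := kss_u4_ge; have := leq_mul y1 y2.
have := kss_r_def; move: (m ^ 4)%N; move: le m6; clear; move: m; lia.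
Qed.

(** If u is n or -n modulo r, then u^8 = -1 modulo r, and the formula for r gives
    u^4 = -13.  So r divides 13^2 + 1 = 170, hence r = 17 as r is at least 17, and
    this contradicts the formula for r since |u| is at least 6. *)
Lemma kss_u_neq_p n : (r %| n ^ 8 + 1)%N -> ~ (m = n %[mod r] \/ (m + n = 0 %[mod r])%N).
Proof.
move=> rn mn.
have r17 := kss_r_ge17.
have rm : (r %| m ^ 8 + 1)%N.
  case: mn => [/eqP|/eqP]; last first.
    rewrite mod0n -/(dvdn _ _) => d.
    have : (r%:Z %| (m + n)%:Z * ((m%:Z - n%:Z) * (m%:Z ^+ 2 + n%:Z ^+ 2) * (m%:Z ^+ 4 + n%:Z ^+ 4)))%Z.
      by apply: dvdz_mulr.
    have -> : (m + n)%:Z * ((m%:Z - n%:Z) * (m%:Z ^+ 2 + n%:Z ^+ 2) * (m%:Z ^+ 4 + n%:Z ^+ 4))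
       = (m ^ 8 + 1)%N%:Z - (n ^ 8 + 1)%N%:Z.
      by rewrite -!natz !natrD !natrX; ring.
    have rnz : (r%:Z %| (n ^ 8 + 1)%N%:Z)%Z by [].
    by move=> h; have := rpredD h rnz; rewrite subrK.
  move=> e; rewrite /dvdn -modnDml -modnXm (eqP e) modnXm modnDml.
  exact: rn.
have d48 : (r %| 48 * (m ^ 4 + 13))%N.
  have := dvdn_mull (1225 * 50) (dvdnn r); rewrite kss_r_def -expnD.
  have -> : (m ^ 8 + 48 * m ^ 4 + 625 = (m ^ 8 + 1) + 48 * (m ^ 4 + 13))%N.
    by move: (m ^ 8)%N (m ^ 4)%N; clear; lia.
  by rewrite dvdn_addr.
have d13 : (r %| m ^ 4 + 13)%N.
  move: d48; rewrite Euclid_dvdM // => /orP[|//] d.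
  have : r \in primes 48 by rewrite mem_primes r_prime.
  by rewrite -[primes 48]/[:: 2; 3]%N !inE => /orP[] /eqP e; rewrite e in r17.
have d170 : (r %| 170)%N.
  have h : (r %| (m ^ 4 + 13) * (m ^ 4 - 13))%N by rewrite dvdn_mulr.
  have m4 : (13 <= m ^ 4)%N.
    by apply: leq_trans kss_u4_ge.2.
  have e : ((m ^ 4 + 13) * (m ^ 4 - 13) + 170 = m ^ 8 + 1)%N.
    by rewrite (expnM m 4 2); move: (m ^ 4)%N m4; clear; nia.
  by move: rm; rewrite -e dvdn_addr.
have : r \in primes 170 by rewrite mem_primes r_prime.
rewrite -[primes 170]/[:: 2; 5; 17]%N !inE => /or3P[] /eqP e; try by rewrite e in r17.
have := kss_r_def; rewrite e.
have [_ y2] := kss_u4_ge; have := leq_mul y2 y2; move: (m ^ 4)%N; clear; lia.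
Qed.

End Arithmetic.

(** * The twist and the final exponentiation *)

Section Twist.

Variables (K : fieldType) (a eta : K).
Hypothesis eta_neq0 : eta != 0.
Local Notation at_ := (twist_coef a eta).
Implicit Types P R S : point K.

Let eta2 := expf_neq0 2 eta_neq0.
Let eta3 := expf_neq0 3 eta_neq0.

Lemma twist_coefE : a = eta ^+ 4 * at_.
Proof. by rewrite /twist_coef mulrA mulfV ?mul1r // expf_neq0. Qed.

Lemma twist_map_inj : injective (twist_map eta).
Proof. by move=> [[x y]|] [[x' y']|] //= [] /(mulfI eta2) -> /(mulfI eta3) ->. Qed.

Lemma twist_slope x1 y1 x2 y2 :
  slope a (eta ^+ 2 * x1, eta ^+ 3 * y1) (eta ^+ 2 * x2, eta ^+ 3 * y2)
  = eta * slope at_ (x1, y1) (x2, y2).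
Proof.
have div4 s t : (eta ^+ 4 * s) / (eta ^+ 3 * t) = eta * (s / t).
  by rewrite -mulf_div; congr (_ * _); field.
have div3 s t : (eta ^+ 3 * s) / (eta ^+ 2 * t) = eta * (s / t).
  by rewrite -mulf_div; congr (_ * _); field.
rewrite /slope !xpair_eqE !(inj_eq (mulfI _)) //; case: ifP => _.
  by rewrite -div4 {1}twist_coefE; congr (_ / _); ring.
by rewrite -div3 !mulrBr.
Qed.

Lemma twist_oppp R : oppp (twist_map eta R) = twist_map eta (oppp R).
Proof. by case: R => [[x y]|] //=; rewrite mulrN. Qed.

Lemma twist_addp R S :
  addp a (twist_map eta R) (twist_map eta S) = twist_map eta (addp at_ R S).
Proof.
case: R S => [[x1 y1]|] [[x2 y2]|] //.
rewrite /twist_map /addp -mulrN !(inj_eq (mulfI _)) //.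
case: ifP => // _; rewrite twist_slope.
by congr (Some (_, _)); ring.
Qed.

Lemma twist_smul x y n :
  smul a (eta ^+ 2 * x) (eta ^+ 3 * y) n = twist_map eta (smul at_ x y n).
Proof. by elim: n => // n IH; rewrite !smulS IH -twist_addp. Qed.

Lemma twist_on_curve R : on_curve a 0 (twist_map eta R) = on_curve at_ 0 R.
Proof.
case: R => [[x y]|] //=; rewrite !addr0 {1}twist_coefE.
have -> : (eta ^+ 3 * y) ^+ 2 = eta ^+ 6 * y ^+ 2 by ring.
have -> : (eta ^+ 2 * x) ^+ 3 + eta ^+ 4 * at_ * (eta ^+ 2 * x)
   = eta ^+ 6 * (x ^+ 3 + at_ * x) by ring.
by rewrite (inj_eq (mulfI _)) // expf_neq0.
Qed.

Lemma twist_line R S P : S != None ->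
  line a (twist_map eta R) (twist_map eta S) (twist_map eta P)
  = eta ^+ 3 * line at_ R S P.
Proof.
case: R S P => [[x1 y1]|] [[x2 y2]|] [[x y]|] //=; rewrite ?mulr0 // => _.
by rewrite -!/(slope _ (_, _) (_, _)) twist_slope; ring.
Qed.

Lemma twist_miller_eval x1 y1 x2 y2 n :
  (forall k, (k <= n)%N -> smul at_ x1 y1 k.+1 != None) ->
  miller_eval a (eta ^+ 2 * x1) (eta ^+ 3 * y1) (eta ^+ 2 * x2) (eta ^+ 3 * y2) n
  = eta ^+ n * miller_eval at_ x1 y1 x2 y2 n.
Proof.
elim: n => [|n IH] fin; first by rewrite mul1r.
rewrite !miller_evalS IH => [|k kn]; last by apply: fin; apply: leqW.
rewrite !twist_smul.
have := twist_line (smul at_ x1 y1 n.+1) (S := Some (x1, y1)) (Some (x2, y2)) isT.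
rewrite [twist_map eta (Some (x1, y1))]/= [twist_map eta (Some (x2, y2))]/= => ->.
case e : (smul at_ x1 y1 n.+2) (fin n.+1 (leqnn _)) => [[x y]|] // _.
rewrite [twist_map eta _]/= /abscissa -mulrBr -mulf_div [eta ^+ n.+1]exprS.
move: (line _ _ _ _ / _) (miller_eval _ _ _ _ _ _) => l f.
have -> : eta ^+ 3 / eta ^+ 2 = eta by field.
by move: (eta ^+ n) => z; ring.
Qed.

End Twist.

Section Frobenius.

Variables (K : fieldType) (p : nat).
Hypothesis p_char : p \in [pchar K].
Implicit Types (x y z : K) (n : nat).

Let pnat n : [pchar K].-nat (p ^ n)%N.
Proof. by rewrite (eq_pnat _ (pcharf_eq p_char)) pnatX pnat_id ?(pcharf_prime p_char) ?orbT. Qed.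

Lemma FpnD n x y : in_Fpn p n x -> in_Fpn p n y -> in_Fpn p n (x + y).
Proof. by rewrite /in_Fpn exprDn_pchar // => -> ->. Qed.

Lemma FpnN n x : in_Fpn p n x -> in_Fpn p n (- x).
Proof. by rewrite /in_Fpn exprNn_pchar // => ->. Qed.

Lemma FpnB n x y : in_Fpn p n x -> in_Fpn p n y -> in_Fpn p n (x - y).
Proof. by move=> hx hy; apply/FpnD/FpnN. Qed.

Lemma FpnM n x y : in_Fpn p n x -> in_Fpn p n y -> in_Fpn p n (x * y).
Proof. by rewrite /in_Fpn exprMn => -> ->. Qed.

Lemma FpnV n x : in_Fpn p n x -> in_Fpn p n x^-1.
Proof. by rewrite /in_Fpn exprVn => ->. Qed.

Lemma FpnX n x k : in_Fpn p n x -> in_Fpn p n (x ^+ k).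
Proof. by rewrite /in_Fpn exprAC => ->. Qed.

Lemma Fpn_nat n k : in_Fpn p n (k%:R : K).
Proof.
elim: k => [|k IH]; last by rewrite mulrS; apply: FpnD => //; exact: expr1n.
by rewrite /in_Fpn expr0n expn_eq0 eqn0Ngt prime_gt0 ?(pcharf_prime p_char).
Qed.

Lemma FpnW m n x : (m %| n)%N -> in_Fpn p m x -> in_Fpn p n x.
Proof.
case/dvdnP=> k -> h; elim: k => [|k IH]; first exact: expr1.
by rewrite /in_Fpn mulSn expnD exprM h.
Qed.

Definition point_Fpn n (P : point K) : Prop :=
  if P is Some (x, y) then in_Fpn p n x /\ in_Fpn p n y else True.

Lemma addp_Fpn n a P Q : in_Fpn p n a -> point_Fpn n P -> point_Fpn n Q ->
  point_Fpn n (addp a P Q).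
Proof.
case: P Q => [[x1 y1]|] [[x2 y2]|] // ha [hx1 hy1] [hx2 hy2].
rewrite /addp; case: ifP => // _.
have hl : in_Fpn p n (slope a (x1, y1) (x2, y2)).
  rewrite /slope; case: ifP => _; apply/FpnM/FpnV.
  - apply: FpnD => //; apply: FpnM; [exact: Fpn_nat | exact: FpnX].
  - by apply: FpnM => //; exact: Fpn_nat.
  - exact: FpnB.
  exact: FpnB.
have h3 : in_Fpn p n (slope a (x1, y1) (x2, y2) ^+ 2 - x1 - x2).
  by apply: FpnB => //; apply: FpnB => //; apply: FpnX.
by split=> //; apply: FpnB => //; apply: FpnM => //; apply: FpnB.
Qed.

Lemma smul_Fpn n a x y k : in_Fpn p n a -> in_Fpn p n x -> in_Fpn p n y ->
  point_Fpn n (smul a x y k).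
Proof.
move=> ha hx hy; elim: k => // k IH; rewrite smulS; exact: addp_Fpn.
Qed.

(** The factors that the final exponentiation kills.  Squares are considered
    because eta itself is not in F_{p^8}, but eta^2 is. *)
Definition half_subfield z := z != 0 /\ in_Fpn p 8 (z ^+ 2).

Lemma half_Fpn z : z != 0 -> in_Fpn p 8 z -> half_subfield z.
Proof. by move=> z0 h; split=> //; apply: FpnX. Qed.

Lemma halfM y z : half_subfield y -> half_subfield z -> half_subfield (y * z).
Proof. by move=> [y0 hy] [z0 hz]; split; rewrite ?mulf_neq0 // exprMn; apply: FpnM. Qed.

Lemma halfV z : half_subfield z -> half_subfield z^-1.
Proof. by move=> [z0 h]; split; rewrite ?invr_neq0 // exprVn; apply: FpnV. Qed.

Lemma halfN z : half_subfield z -> half_subfield (- z).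
Proof. by move=> [z0 h]; split; rewrite ?oppr_eq0 // sqrrN. Qed.

Lemma halfX z k : half_subfield z -> half_subfield (z ^+ k).
Proof. by move=> [z0 h]; split; rewrite ?expf_neq0 // exprAC; apply: FpnX. Qed.

(** The final exponent is a multiple of 2 (p^8 - 1), since the cofactor of the
    odd number r in the even number p^8 + 1 is even. *)
Lemma half_final_exp r z : prime r -> odd r -> (r %| p ^ 8 + 1)%N -> odd p ->
  half_subfield z -> z ^+ ((p ^ 16 - 1) %/ r) = 1.
Proof.
move=> r_prime r_odd /dvdnP[k ek] p_odd [z0 hz].
have k_even : ~~ odd k.
  have := congr1 odd ek; rewrite oddD oddX p_odd /= oddM r_odd andbT => /esym ->.
  by [].
have -> : ((p ^ 16 - 1) %/ r = (p ^ 8 - 1) * k)%N.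
  have -> : (p ^ 16 - 1 = (p ^ 8 - 1) * (p ^ 8 + 1))%N.
    by rewrite (expnM p 8 2) -[X in (_ - X)%N]/(1 ^ 2)%N subn_sqr.
  by rewrite ek mulnA mulnK // prime_gt0.
have /dvdnP[j ->] : (2 %| k)%N by rewrite dvdn2.
have p0 := prime_gt0 (pcharf_prime p_char).
rewrite mulnA mulnC exprM exprM.
suff -> : z ^+ 2 ^+ (p ^ 8 - 1) = 1 by rewrite expr1n.
apply: (mulIf (expf_neq0 2 z0)); rewrite mul1r -exprSr subn1 prednK //.
by rewrite expn_gt0 p0.
Qed.

End Frobenius.

(** * Comparison of the net with the Miller function *)

Section Comparison.

Variables (K : fieldType) (p : nat) (a b x1 y1 x2 y2 : K) (W : int * int -> K).
Hypothesis p_char : p \in [pchar K].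
Hypothesis two_neq0 : 2 != 0 :> K.
Hypothesis hW : stange_net a b (x1, y1) (x2, y2) W.
Let Q : point K := Some (x1, y1).
Let P : point K := Some (x2, y2).
Hypotheses (Q_on : on_curve a b Q) (P_on : on_curve a b P).
Variable r : nat.
Hypotheses (r_prime : prime r) (r_odd : odd r) (smul_r : smul a x1 y1 r = None).
Hypothesis P_indep : independent a x1 y1 P.
Hypotheses (a_F : in_Fpn p 8 a) (x1_F : in_Fpn p 8 x1) (y1_F : in_Fpn p 8 y1)
  (x2_F : in_Fpn p 8 x2).
Local Notation smul := (smul a x1 y1).
Local Notation half := (half_subfield p).
Local Notation net0 := (net0 W).
Local Notation net1 := (net1 W).

Let y1_neq0 : y1 != 0 := base_y_neq0 r_odd smul_r.

Lemma smul_half_abscissa n x y : smul n = Some (x, y) -> half (x2 - x).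
Proof.
move=> e; apply: half_Fpn => //.
  by rewrite subr_eq0 (independent_abscissa two_neq0 Q_on r_prime r_odd smul_r P_on P_indep e).
apply: FpnB => //.
by have := smul_Fpn p_char n a_F x1_F y1_F; rewrite e => -[].
Qed.

(** By [net0_abscissa], each value is obtained from the preceding ones by
    products and quotients with differences of abscissae. *)
Lemma net0_half n : (n.+3 < r)%N -> half (net0 n.+1) /\ half (net0 n.+2).
Proof.
have half1 : half (1 : K) by apply: half_Fpn; [exact: oner_neq0 | exact: expr1n].
have [_ [w0 [_ [w1 [_ [_ [w2 _]]]]]]] := hW.
elim: n => [|n IH] nr.
  rewrite /net0 w1 w2; split=> //; apply: half_Fpn => //; first by rewrite mulf_neq0.
  by apply: FpnM => //; apply: Fpn_nat.
have nr' := ltnW nr; have [h1 h2] := IH nr'; split=> //.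
have [|[x y] e] := smul_lt_finite two_neq0 Q_on r_prime r_odd smul_r (n := n.+2).
  exact: ltnW nr'.
have nx : x != x1.
  exact: (smul_lt_abscissa two_neq0 Q_on r_prime r_odd smul_r (n := n.+2) isT nr' e).
have [n1 n2 h] := net0_abscissa two_neq0 hW Q_on y1_neq0 r_prime r_odd smul_r nr' e.
have hx : half (x1 - x).
  apply: half_Fpn => //; first by rewrite subr_eq0 eq_sym.
  by apply: FpnB => //; have := smul_Fpn p_char n.+2 a_F x1_F y1_F; rewrite e => -[].
have -> : net0 n.+3 = net0 n.+2 ^+ 2 * (x1 - x) / net0 n.+1 by rewrite -h mulfK.
by apply: halfM => //; [apply: halfM => //; apply: halfX | apply: halfV].
Qed.

(** By [net1_miller], the quotients of consecutive values of net1 are the steps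
    of the Miller recursion, up to factors that the final exponentiation
    kills. *)
Lemma net1_half n : (n.+3 < r)%N -> exists k, [/\ half k,
  miller_eval a x1 y1 x2 y2 n != 0 & net1 n.+1 = k * miller_eval a x1 y1 x2 y2 n].
Proof.
have half1 : half (1 : K) by apply: half_Fpn; [exact: oner_neq0 | exact: expr1n].
have [_ [w0 [_ [w1 [_ [v1 [w2 _]]]]]]] := hW.
elim: n => [|n IH] nr.
  by exists 1; rewrite /net1 v1 mulr1 oner_neq0.
have nr1 := ltnW nr; have nr2 := ltnW nr1.
have [k [hk f0 ek]] := IH nr1.
have [|[x y] e] := smul_lt_finite two_neq0 Q_on r_prime r_odd smul_r (n := n.+1).
  exact: ltnW nr2.
have [|[x' y'] e'] := smul_lt_finite two_neq0 Q_on r_prime r_odd smul_r (n := n.+2).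
  exact: nr2.
have [v0 l0 rec] := net1_miller two_neq0 hW Q_on y1_neq0 r_prime r_odd smul_r P_on P_indep nr2 e.
have [h1 h2] := net0_half nr1.
have hx := smul_half_abscissa e; have hx' := smul_half_abscissa e'.
have hx1 : half (x2 - x1) := smul_half_abscissa (n := 1) (erefl _).
exists (k * (net0 n.+2 * (x2 - x') / (net0 n.+1 * (x2 - x) * (x2 - x1)))).
rewrite miller_evalS e' /abscissa.
have [n1 _] := h1; have [nx _] := hx; have [nx' _] := hx'; have [nx1 _] := hx1.
split.
- do 2 apply: halfM => //; last by apply: halfV; do 2 apply: halfM => //.
  exact: halfM.
- by rewrite !mulf_neq0 // invr_neq0.
have -> : net1 n.+2 = net0 n.+2 * line a (smul n.+1) Q P * net1 n.+1
    / (net0 n.+1 * (x2 - x) * (x2 - x1)).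
  rewrite -rec; field; by rewrite n1 nx nx1.
rewrite ek; move: (line _ _ _ _) (miller_eval _ _ _ _ _ _) => l f.
by field; rewrite n1 nx nx' nx1.
Qed.

(** The relations for negative u follow from those for positive u, because all
    their terms are even in u: W(-n,0) = -W(n,0), and the ordinate of [u]Q is
    odd. *)
Lemma net_multiple (u : int) n x y :
  `|u|%N = n.+3 -> (n.+4.+1 < r)%N -> smul n.+3 = Some (x, y) ->
  exists y', [/\ mulp a u Q = Some (x, y'),
    x1 * W (u, 0) ^+ 2 - W (u - 1, 0) * W (u + 1, 0) = x * W (u, 0) ^+ 2,
    (W (u - 1, 0) ^+ 2 * W (u + 2, 0) - W (u + 1, 0) ^+ 2 * W (u - 2, 0))
      / (4 * y1) = y' * W (u, 0) ^+ 3
  & half (W (u, 0))].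
Proof.
move=> eu nr e; have nr1 := ltnW nr; have nr2 := ltnW nr1.
have [_ _ hx] := net0_abscissa two_neq0 hW Q_on y1_neq0 r_prime r_odd smul_r nr1 e.
have hy := net0_ordinate two_neq0 hW Q_on y1_neq0 r_prime r_odd smul_r nr e.
have [_ h3] := net0_half nr1.
have four_neq0 : 4 != 0 :> K.
  by have -> : 4 = 2 * 2 :> K by [ring]; rewrite mulf_neq0.
have opp m : W (- Posz m, 0) = - net0 m by rewrite -(stange_net_opp hW) oppr0.
have [m1 m2] : Posz n.+3 - 1 = Posz n.+2 /\ Posz n.+3 - 2 = Posz n.+1 by clear; lia.
have [p1 p2] : Posz n.+3 + 1 = Posz n.+4 /\ Posz n.+3 + 2 = Posz n.+4.+1 by clear; lia.
case: u eu => k eu.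
  have -> : k = n.+3 by exact: eu.
  rewrite m1 m2 p1 p2 -!/(net0 _); exists y; split=> //.
    by rewrite [X in _ - X]mulrC hx; ring.
  by rewrite -hy; move: (net0 n.+3) => z; field; rewrite y1_neq0 four_neq0.
have {k eu} -> : Negz k = - Posz n.+3 by rewrite NegzE; congr (- Posz _); exact: eu.
have -> : - Posz n.+3 - 1 = - Posz n.+4 by rewrite -opprD p1.
have -> : - Posz n.+3 - 2 = - Posz n.+4.+1 by rewrite -opprD p2.
have -> : - Posz n.+3 + 1 = - Posz n.+2 by rewrite -m1 opprB addrC.
have -> : - Posz n.+3 + 2 = - Posz n.+1 by rewrite -m2 opprB addrC.
rewrite !opp; exists (- y); split.
- by rewrite -[LHS]/(oppp (smul n.+3)) e.
- by rewrite mulrNN hx; ring.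
- have -> : (- net0 n.+4) ^+ 2 * - net0 n.+1 - (- net0 n.+2) ^+ 2 * - net0 n.+4.+1
     = 4 * y1 * y * net0 n.+3 ^+ 3 by rewrite hy; ring.
  by move: (net0 n.+3) => z; field; rewrite y1_neq0 four_neq0.
exact: halfN.
Qed.

End Comparison.

(** * The pairing *)

Lemma subp_eq0 (F : fieldType) (a : F) (R S : point F) : subp a R S = None -> R = S.
Proof.
case: R S => [[x1 y1]|] [[x2 y2]|] //; rewrite /subp /oppp /addp opprK.
by case: ifP => // /andP[/eqP -> /eqP ->].
Qed.

(** Uniqueness in the basis: an element of F_p has its only coordinate along 1,
    and eta^2 x, eta^3 y with x, y in F_{p^4} have theirs along eta^2, eta^3. *)
Lemma twist_point_not_rational (K : fieldType) (p : nat) (eta x y : K) :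
  p \in [pchar K] -> quartic_twist_param p eta ->
  in_Fpn p 1 (eta ^+ 2 * x) -> in_Fpn p 1 (eta ^+ 3 * y) ->
  in_Fpn p 4 x -> in_Fpn p 4 y -> x = 0 /\ y = 0.
Proof.
move=> p_char [eta0 eta16 eta4 basis] hX hY hx hy.
have z4 : in_Fpn p 4 (0 : K) by exact: (Fpn_nat p_char 4 0).
have coord (i : 'I_4) z c : i != 0 -> in_Fpn p 1 z -> in_Fpn p 4 c ->
    z = c * eta ^+ i -> c = 0.
  move=> i0 hz hc ez.
  have [f [_ uniq]] := basis z (FpnW (isT : (1 %| 16)%N) hz).
  have e1 : f = [ffun j => if j == i then c else 0].
    apply: uniq; split=> [j|]; first by rewrite ffunE; case: ifP.
    rewrite (bigD1 i) //= ffunE eqxx big1 ?addr0 // => j /negPf ji.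
    by rewrite ffunE ji mul0r.
  have e2 : f = [ffun j => if j == 0 then z else 0].
    apply: uniq; split=> [j|].
      by rewrite ffunE; case: ifP => // _; exact: FpnW hz.
    rewrite (bigD1 0) //= ffunE eqxx mulr1 big1 ?addr0 // => j /negPf ji.
    by rewrite ffunE ji mul0r.
  by move: e1; rewrite e2 => /ffunP/(_ i); rewrite !ffunE eqxx (negPf i0) => <-.
split.
  by apply: (coord (@inord 3 2) _ _ _ hX hx); [rewrite -val_eqE /= inordK | rewrite inordK // mulrC].
by apply: (coord (@inord 3 3) _ _ _ hY hy); [rewrite -val_eqE /= inordK | rewrite inordK // mulrC].
Qed.

Theorem mainTheorem2 (u : int) (p r : nat) (t : int) (a0 : 'F_p)
  (hE : kss16_curve u r t a0)
  (* K is an algebraic closure of F_p, and E : y^2 = x^3 + a x over it. *)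
  (K : closedFieldType) (iota : {rmorphism 'F_p -> K})
  (hK : integralRange iota)
  (a : K) (ha : a = iota a0)
  (P Q : point K)
  (hP : in_G1 p r a 0 P) (hP0 : P <> None)
  (hQ : in_G2 p r a 0 Q) (hQ0 : Q <> None)
  (eta : K) (heta : quartic_twist_param p eta)
  (xP yP xQ yQ : K)
  (hPt : on_curve (twist_coef a eta) 0 (Some (xP, yP)))
  (hQt : on_curve (twist_coef a eta) 0 (Some (xQ, yQ)))
  (hsP : twist_map eta (Some (xP, yP)) = P)
  (hsQ : twist_map eta (Some (xQ, yQ)) = Q)
  (hxQ : in_Fpn p 4 xQ) (hyQ : in_Fpn p 4 yQ)
  (W : int * int -> K)
  (hW : stange_net (twist_coef a eta) 0 (xQ, yQ) (xP, yP) W) :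
  let A := xQ * W (u, 0) ^+ 2 - W (u - 1, 0) * W (u + 1, 0) in
  let B := (W (u - 1, 0) ^+ 2 * W (u + 2, 0)
            - W (u + 1, 0) ^+ 2 * W (u - 2, 0)) / (4 * yQ) in
  let l1 := (A - eta ^+ (2 * (p - 1)) * W (u, 0) ^+ 2 * xQ ^+ p)
              * (W (u, 0) ^+ 3 * yP - B)
            - (B - eta ^+ (3 * (p - 1)) * W (u, 0) ^+ 3 * yQ ^+ p)
              * (W (u, 0) ^+ 2 * xP - A) in
  let l2 := (3 * eta ^+ 4 * xQ ^+ 2 + a) * xP - 2 * eta ^+ 4 * yQ * yP
            + 2 * eta ^+ 4 * yQ ^+ 2 - 3 * eta ^+ 4 * xQ ^+ 3 - a * xQ in
  optimal_ate p r u a Q P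
    = ((W (u, 1) * l1) ^+ (p ^ 3) * l2) ^+ ((p ^ 16 - 1) %/ r).
Proof.
have [p_prime p_gt3 r_prime _ r_def _ a0_neq0 _ _ embed] := hE.
have [eta0 eta16 eta4 _] := heta.
have p_char : p \in [pchar K] by apply: (rmorph_pchar iota); apply: pchar_Fp.
have p_gt0 := prime_gt0 p_prime.
have p_odd : odd p by case: (even_prime p_prime) => // p2; rewrite p2 in p_gt3.
have two_neq0 : 2 != 0 :> K.
  by rewrite -(dvdn_pcharf p_char); apply/negP => /dvdn_leq => /(_ isT); rewrite leqNgt (ltnW p_gt3).
have r_odd := kss_r_odd p_prime r_prime embed.
have r_dvd := kss_r_dvd p_prime r_prime embed.
have u_ge6 := kss_u_ge6 p_prime r_prime r_def embed.
have u_lt := kss_u_lt p_prime r_prime r_def embed.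
have a_F1 : in_Fpn p 1 a.
  rewrite /in_Fpn ha -rmorphXn expn1; congr (iota _).
  by have := expf_card a0; rewrite card_Fp.
have a_neq0 : a != 0 by rewrite ha fmorph_eq0.
set b := twist_coef a eta in hPt hQt hW *.
have b_F4 : in_Fpn p 4 b by apply: FpnM => //; [exact: FpnV | exact: FpnW a_F1].
have rP : smul a (eta ^+ 2 * xP) (eta ^+ 3 * yP) r = None.
  by case: hP => _ h _; rewrite -hsP in h.
have rQ : smul a (eta ^+ 2 * xQ) (eta ^+ 3 * yQ) r = None.
  by case: hQ => _ h _; rewrite -hsQ in h.
have smul_r : smul b xQ yQ r = None.
  by move: rQ; rewrite twist_smul //; case: (smul b _ _ _) => [[]|].
have P_F : in_Fpn p 1 (eta ^+ 2 * xP) /\ in_Fpn p 1 (eta ^+ 3 * yP).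
  case: hP => _ _ /subp_eq0; rewrite -hsP /=.
  by case=> h1 h2; rewrite /in_Fpn !expn1 h1 h2.
have expt k : (k + k * (p - 1) = k * p)%N by rewrite -mulnS subn1 prednK.
(* The twisted point of pi_p(Q) = [p]Q. *)
have frobQ : smul b xQ yQ p
    = Some (eta ^+ (2 * (p - 1)) * xQ ^+ p, eta ^+ (3 * (p - 1)) * yQ ^+ p).
  apply: (twist_map_inj eta0); rewrite -twist_smul //.
  case: hQ => _ _ /subp_eq0; rewrite -hsQ [frobp _ _]/= => e.
  rewrite -[LHS]/(mulp a p (twist_map eta (Some (xQ, yQ)))) -e.
  rewrite [RHS]/= [(eta ^+ 2 * xQ) ^+ p]exprMn [(eta ^+ 3 * yQ) ^+ p]exprMn !mulrA -!exprM -!exprD.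
  by rewrite !expt.
(* If P' were in the orbit of Q', it would be (0,0), whose odd multiples are
   finite. *)
have P_indep : independent b xQ yQ (Some (xP, yP)).
  move=> n en; have := smul_Fpn p_char n b_F4 hxQ hyQ; rewrite -en => -[hx hy].
  have [ex ey] := twist_point_not_rational p_char heta P_F.1 P_F.2 hx hy.
  by move: rP; rewrite ex ey !mulr0 smul_order2 // r_odd.
have up_neq := kss_u_neq_p p_prime r_prime r_def embed r_dvd.
have le48 : (4 %| 8)%N by [].
have b_F : in_Fpn p 8 b := FpnW le48 b_F4.
have xQ_F : in_Fpn p 8 xQ := FpnW le48 hxQ.
have yQ_F : in_Fpn p 8 yQ := FpnW le48 hyQ.
(* eta^2 is a square root of an element of F_{p^4}, so x -> x^(p^4) maps it to
   eta^2 or -eta^2. *)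
have eta_half : half_subfield p eta.
  split=> //; rewrite /in_Fpn.
  have : eta ^+ 2 ^+ (p ^ 4) = eta ^+ 2 \/ eta ^+ 2 ^+ (p ^ 4) = - eta ^+ 2.
    have : (eta ^+ 2 ^+ (p ^ 4)) ^+ 2 == eta ^+ 2 ^+ 2.
      by rewrite exprAC -[eta ^+ 2 ^+ 2]exprM; apply/eqP; exact: eta4.
    by rewrite eqf_sqr => /orP[] /eqP; [left | right].
  rewrite (expnD p 4 4) exprM => -[] e; rewrite !e //.
  by rewrite exprNn -signr_odd oddX p_odd orbT expr1 e mulN1r opprK.
have xP_F : in_Fpn p 8 xP.
  have -> : xP = (eta ^+ 2)^-1 * (eta ^+ 2 * xP) by rewrite mulKf // expf_neq0.
  by apply: FpnM; [apply: FpnV; case: eta_half | exact: FpnW P_F.1].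
have four_neq0 : 4 != 0 :> K by have -> : 4 = 2 * 2 :> K by [ring]; rewrite mulf_neq0.
have yQ_neq0 : yQ != 0 := base_y_neq0 r_odd smul_r.
have nonsingular x : (weierstrass_rhs a 0).[x] = 0 -> 3 * x ^+ 2 + a != 0.
  rewrite rhs_horner addr0 => ex.
  have : x * (x ^+ 2 + a) == 0 by rewrite -ex; apply/eqP; ring.
  rewrite mulf_eq0 => /orP[/eqP->|]; first by rewrite expr0n mulr0 add0r.
  rewrite addr_eq0 => /eqP ->; have -> : 3 * - a + a = - (2 * a) by ring.
  by rewrite oppr_eq0 mulf_neq0.
(* As |u| is at least 6, all the indices from |u| - 2 to |u| + 2 are positive. *)
have [n en] : exists n, `|u|%N = n.+3.
  by move: u_ge6; case: `|u|%N => [|[|[|k]]] // _; exists k.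
have nr : (n.+4.+1 < r)%N by move: u_lt; rewrite en; clear; lia.
have nr1 := ltnW nr; have nr2 := ltnW nr1.
have [|[xu yu] eu] := smul_lt_finite two_neq0 hQt r_prime r_odd smul_r (n := n.+3).
  exact: nr2.
have [y' [euQ eA eB hw]] := net_multiple p_char two_neq0 hW hQt r_prime r_odd smul_r b_F xQ_F yQ_F en nr eu.
have [k [hk f0 ek]] := net1_half p_char two_neq0 hW hQt hPt r_prime r_odd smul_r P_indep b_F xQ_F yQ_F xP_F nr.
have hx := smul_half_abscissa p_char two_neq0 hQt hPt r_prime r_odd smul_r P_indep b_F xQ_F yQ_F xP_F eu.
have tP : on_curve a 0 (Some (eta ^+ 2 * xP, eta ^+ 3 * yP)).
  by rewrite -[Some _]/(twist_map eta (Some (xP, yP))) twist_on_curve.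
have tQ : on_curve a 0 (Some (eta ^+ 2 * xQ, eta ^+ 3 * yQ)).
  by rewrite -[Some _]/(twist_map eta (Some (xQ, yQ))) twist_on_curve.
have t_indep : independent a (eta ^+ 2 * xQ) (eta ^+ 3 * yQ) (Some (eta ^+ 2 * xP, eta ^+ 3 * yP)).
  move=> j; rewrite twist_smul // -[Some _]/(twist_map eta (Some (xP, yP))) => ej.
  exact: (P_indep j (twist_map_inj eta0 ej)).
have tf : miller_eval a (eta ^+ 2 * xQ) (eta ^+ 3 * yQ) (eta ^+ 2 * xP) (eta ^+ 3 * yP) n.+2
    = eta ^+ n.+2 * miller_eval b xQ yQ xP yP n.+2.
  apply: twist_miller_eval => // j jn.
  have [|xy ->] // := smul_lt_finite two_neq0 hQt r_prime r_odd smul_r (n := j.+1).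
  by apply: leq_ltn_trans nr2; rewrite ltnS.
(* For u = -m negative, f_{-m,Q} is the inverse of the product of f_{m,Q} and the
   vertical at [m]Q, and [net1_opp] is the corresponding relation for the net. *)
have [k1 [hk1 eF]] : exists k1, half_subfield p k1 /\
    funeval (miller a 0 u Q) P = k1 * W (u, 1).
  rewrite -hsP -hsQ.
  case: (u) en => j ej.
    have -> : j = n.+3 by exact: ej.
    rewrite -[W _]/(net1 W n.+3) ek.
    exists (eta ^+ n.+2 / k); split; first by apply: halfM; [exact: halfX | exact: halfV].
    rewrite (miller_value two_neq0 nonsingular tQ r_prime r_odd rQ tP t_indep nr2) tf.
    case: hk => k0 _; move: (miller_eval b _ _ _ _ _) => f; move: (eta ^+ n.+2) => z.
    by field.
  have {j ej} -> : Negz j = - Posz n.+3 by rewrite NegzE; congr (- Posz _); exact: ej.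
  have := net1_opp two_neq0 hW hQt yQ_neq0 r_prime r_odd smul_r nr1 eu.
  rewrite ek; set v := W _; set f := miller_eval _ _ _ _ _ _ in f0 tf ek *.
  move=> ev; have [k0 _] := hk; have [x0 _] := hx.
  have ew : half_subfield p (net0 W n.+3).
    by have [] := net0_half p_char two_neq0 hW hQt r_prime r_odd smul_r b_F xQ_F yQ_F nr1.
  have [w0 _] := ew.
  exists (- (k / (eta ^+ n.+2 * eta ^+ 2 * net0 W n.+3 ^+ 2 * (xP - xu) ^+ 2))); split.
    apply: halfN; apply: halfM => //; apply: halfV.
    apply: halfM; last exact: halfX.
    apply: halfM; last exact: halfX.
    by apply: halfM; exact: halfX.
  have exu : smul a (eta ^+ 2 * xQ) (eta ^+ 3 * yQ) n.+3 = Some (eta ^+ 2 * xu, eta ^+ 3 * yu).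
    by rewrite twist_smul // eu.
  have f1 : miller_eval a (eta ^+ 2 * xQ) (eta ^+ 3 * yQ) (eta ^+ 2 * xP) (eta ^+ 3 * yP) n.+2 != 0.
    by rewrite tf mulf_neq0 // expf_neq0.
  apply: etrans (miller_value_neg two_neq0 nonsingular tQ r_prime r_odd rQ tP t_indep nr2 exu f1) _.
  have -> : v = net0 W n.+3 ^+ 2 * (xu - xP) / (k * f).
    by rewrite -ev mulrC mulKf // mulf_neq0.
  rewrite tf -mulrBr; move: (net0 W n.+3) (eta ^+ n.+2) (expf_neq0 n.+2 eta0) w0 => w z z0 w0.
  by field; rewrite f0 k0 x0 w0 z0 eta0.
have smul_F m x y : smul b xQ yQ m = Some (x, y) -> in_Fpn p 8 x.
  by move=> e; have := smul_Fpn p_char m b_F xQ_F yQ_F; rewrite e => -[].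
move: frobQ; set xp := _ * xQ ^+ p; set yp := _ * yQ ^+ p => frobQ.
have xup : xp - xu != 0.
  rewrite subr_eq0 eq_sym; apply/eqP => ex; apply: up_neq; rewrite en.
  exact: (smul_abscissa two_neq0 hQt r_prime r_odd smul_r eu frobQ ex).
have hup : half_subfield p (xu - xp).
  apply: half_Fpn; first by rewrite -opprB oppr_eq0.
  apply: FpnB => //; [exact: (smul_F _ _ _ eu) | exact: (smul_F _ _ _ frobQ)].
have [w0 _] := hw.
move=> A B l1 l2.
(* l1 is this line on the twist, multiplied by the denominators of the slope and
   of the coordinates of [u]Q'. *)
have el1 : line a (mulp a u Q) (mulp a p Q) P
    = eta ^+ 3 / (W (u, 0) ^+ 4.+1 * (xu - xp)) * l1.
  have mulpE j : mulp a j Q = twist_map eta (mulp b j (Some (xQ, yQ))).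
    rewrite -hsQ; case: j => j; first exact: twist_smul.
    by rewrite -[LHS]/(oppp (smul a (eta ^+ 2 * xQ) (eta ^+ 3 * yQ) j.+1)) twist_smul // twist_oppp.
  rewrite !mulpE -hsP euQ -[mulp b p _]/(smul b xQ yQ p) frobQ.
  rewrite twist_line // /line /slope xpair_eqE eq_sym.
  rewrite -subr_eq0 (negPf xup) /=.
  rewrite /l1 /A /B eA eB.
  have -> : eta ^+ (2 * (p - 1)) * W (u, 0) ^+ 2 * xQ ^+ p = W (u, 0) ^+ 2 * xp.
    by rewrite /xp; ring.
  have -> : eta ^+ (3 * (p - 1)) * W (u, 0) ^+ 3 * yQ ^+ p = W (u, 0) ^+ 3 * yp.
    by rewrite /yp; ring.
  move: (W (u, 0)) w0 xp yp xup {frobQ hup eA eB hw} => w w0 xp' yp' xup.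
  by field; rewrite w0 xup -opprB oppr_eq0 xup.
(* l2 is this line on the twist times -2 y_{Q'} eta^4. *)
have el2 : line a Q Q P = - (2 * yQ * eta)^-1 * l2.
  rewrite -hsP -hsQ twist_line // /line /slope eqxx /l2.
  have : a = eta ^+ 4 * b by exact: twist_coefE.
  rewrite -/b; move: (b) => c ->.
  by field; rewrite eta0 yQ_neq0.
have hk2 : half_subfield p (eta ^+ 3 / (W (u, 0) ^+ 4.+1 * (xu - xp))).
  by apply: halfM; [exact: halfX | apply: halfV; apply: halfM => //; exact: halfX].
have hk3 : half_subfield p (- (2 * yQ * eta)^-1).
  apply: halfN; apply: halfV; apply: halfM => //; apply: half_Fpn; first by rewrite mulf_neq0.
  by apply: FpnM => //; exact: (Fpn_nat p_char 8 2).
rewrite /optimal_ate eF el1 el2.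
move: (_ / (_ * _)) (- (2 * yQ * eta)^-1) hk2 hk3 => k2 k3 hk2 hk3.
have kill (z : K) : half_subfield p z -> z ^+ ((p ^ 16 - 1) %/ r) = 1.
  exact: (half_final_exp p_char r_prime r_odd r_dvd p_odd).
have -> : k1 * W (u, 1) * (k2 * l1) = (k1 * k2) * (W (u, 1) * l1) by ring.
have -> : ((k1 * k2) * (W (u, 1) * l1)) ^+ (p ^ 3) * (k3 * l2)
   = ((k1 * k2) ^+ (p ^ 3) * k3) * ((W (u, 1) * l1) ^+ (p ^ 3) * l2).
  by rewrite exprMn mulrACA.
have kk : half_subfield p ((k1 * k2) ^+ (p ^ 3) * k3).
  by apply: halfM => //; apply: halfX; apply: halfM.
by rewrite [LHS]exprMn (kill _ kk) mul1r.
Qed.
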